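(* All generalized quintic polynomial Liénard systems having a linear type global center at the origin can be written, after a rescaling of the variables $x$, $y$ and $t$, as $$\dot x=y,\qquad \dot y=-(x+ax^3+x^5)-bxy,$$ where $a>-2$ and $b\neq 0$. All generalized quintic polynomial Liénard systems having a nilpotent type global center at the origin can be written, after a rescaling of the variables $x$, $y$ and $t$, as $$\dot x=y,\qquad \dot y=-(x^3+x^5)-cxy,$$ where $c\in(-2\sqrt2,0)\cup(0,2\sqrt2)$.
   Context: A generalized polynomial Liénard system is a system $\dot x=y$, $\dot y=-g(x)-f(x)y$ with $g(x)=\sum_{i=r}^{m}a_ix^i$, $f(x)=\sum_{i=s}^{n}b_ix^i$, where $m,n,r,s\in\mathbb{N}$ ($0$ included), the coefficients are real and $a_ra_mb_sb_n\neq 0$ (in particular neither $f$ nor $g$ is identically zero). It is quintic if it is a polynomial differential system of degree $5$, i.e. $\max(m,n+1)=5$. A rescaling of the variables is a change $(x,y,t)\mapsto(\alpha x,\beta y,\gamma t)$ with nonzero real constants $\alpha,\beta,\gamma$. An equilibrium $p$ of a planar differential system is a center if it has a neighbourhood $U$ such that $U\setminus\{p\}$ is filled with periodic (closed) orbits. The period annulus of a center $p$ is the maximal connected set of periodic orbits surrounding $p$ and having $p$ in its boundary. A center $p$ is a global center if its period annulus is $\mathbb{R}^2\setminus\{p\}$. A (global) center is of linear type if the Jacobian matrix of the system at it has (nonzero) purely imaginary eigenvalues, and of nilpotent type if both eigenvalues of that Jacobian matrix are zero but the matrix is not identically zero. *)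

(* Defs.v *)
From mathcomp Require Import all_boot all_order all_algebra.
From mathcomp Require Import all_classical all_reals all_analysis.
From mathcomp Require Import complex.
Set Implicit Arguments.
Unset Strict Implicit.
Unset Printing Implicit Defensive.
Import Order.TTheory GRing.Theory Num.Theory.
Import numFieldNormedType.Exports.
Local Open Scope classical_set_scope.
Local Open Scope ring_scope.

(* A planar differential system (x', y') = X (x, y) is given by its vector
   field X : R * R -> R * R; R * R carries the product topology. *)

Definition equilibrium (R : realType) (X : R * R -> R * R) (p : R * R) : Prop :=
  X p = 0.

Definition solution (R : realType) (X : R * R -> R * R) (phi : R -> R * R)
    : Prop :=
  forall t : R, is_derive t (1 : R) phi (X (phi t)).

(* Equilibria are excluded: the underlying periodic solution is not constant. *)
Definition periodic_orbit (R : realType) (X : R * R -> R * R)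
    (gamma : set (R * R)) : Prop :=
  exists phi : R -> R * R,
    [/\ solution X phi,
        (exists2 T : R, 0 < T & periodic phi T),
        (exists t : R, phi t != phi 0) &
        gamma = range phi].

Definition filled_with_periodic_orbits (R : realType) (X : R * R -> R * R)
    (A : set (R * R)) : Prop :=
  forall q, A q ->
    exists gamma, [/\ periodic_orbit X gamma, gamma q & gamma `<=` A].

Definition center (R : realType) (X : R * R -> R * R) (p : R * R) : Prop :=
  equilibrium X p /\
  exists2 U : set (R * R), nbhs p U &
    filled_with_periodic_orbits X (U `\` [set p]).

(* p lies in the interior of the closed curve gamma, i.e. in a bounded
   connected component of its complement. *)
Definition surrounds (R : realType) (gamma : set (R * R)) (p : R * R) : Prop :=
  ~ gamma p /\ bounded_set (connected_component (~` gamma) p).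

Definition boundary (T : topologicalType) (A : set T) : set T :=
  closure A `\` interior A.

Definition connected_annulus (R : realType) (X : R * R -> R * R) (p : R * R)
    (A : set (R * R)) : Prop :=
  [/\ (forall q, A q -> exists gamma,
         [/\ periodic_orbit X gamma, surrounds gamma p, gamma q &
             gamma `<=` A]),
      connected A &
      boundary A p].

Definition period_annulus (R : realType) (X : R * R -> R * R) (p : R * R)
    (A : set (R * R)) : Prop :=
  connected_annulus X p A /\
  forall B : set (R * R), connected_annulus X p B -> A `<=` B -> B = A.

Definition global_center (R : realType) (X : R * R -> R * R) (p : R * R)
    : Prop :=
  center X p /\ period_annulus X p (~` [set p]).

Definition jacobian2 (R : realType) (X : R * R -> R * R) (p : R * R)
    : 'M[R]_2 :=
  \matrix_(i < 2, j < 2)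
    let Xi := fun q : R * R => if i == 0 then (X q).1 else (X q).2 in
    let ej := (if j == 0 then (1, 0) else (0, 1)) : R * R in
    'D_ej Xi p.

(* Eigenvalues are taken in R[i]; a complex eigenvalue always exists, so the
   universal quantifications below are never vacuous. *)
Definition complex_eigenvalue (R : realType) (M : 'M[R]_2) (l : R[i]) : bool :=
  eigenvalue (map_mx (real_complex R) M) l.

Definition linear_type (R : realType) (X : R * R -> R * R) (p : R * R)
    : Prop :=
  forall l : R[i], complex_eigenvalue (jacobian2 X p) l ->
    complex.Re l = 0 /\ l != 0.

Definition nilpotent_type (R : realType) (X : R * R -> R * R) (p : R * R)
    : Prop :=
  (forall l : R[i], complex_eigenvalue (jacobian2 X p) l -> l = 0) /\
  jacobian2 X p != 0.

Definition lienard (R : realType) (g f : {poly R}) : R * R -> R * R :=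
  fun p => (p.2, - g.[p.1] - f.[p.1] * p.2).

(* The polynomial a_r X^r + ... + a_m X^m. *)
Definition poly_between (R : realType) (a : nat -> R) (r m : nat) : {poly R} :=
  \sum_(r <= i < m.+1) a i *: 'X^i.

(* The vector field of the system satisfied by the new variables
   (al * x, be * y) with respect to the new time ga * t. *)
Definition rescale (R : realType) (al be ga : R) (X : R * R -> R * R)
    : R * R -> R * R :=
  fun p => let v := X (p.1 / al, p.2 / be) in
           (al / ga * v.1, be / ga * v.2).

Definition rescales_to (R : realType) (X Y : R * R -> R * R) : Prop :=
  exists al be ga : R,
    [/\ al != 0, be != 0, ga != 0 & rescale al be ga X =1 Y].

(* Main.v *)
(* A global center puts every point other than the origin on a nonconstant
   periodic orbit that avoids the origin.  Along such an orbit a function of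
   (x, y) reaches its extrema, where its derivative along the field vanishes;
   this replaces stability arguments whenever a Lyapunov function or a trapping
   region is at hand.
   - f has degree at most 2, since otherwise (after a time reversal) an orbit
     starting on y = x^3 with x large runs off to infinity; so g has degree 5;
   - f has no x^2 term, because of a Lyapunov function near infinity;
   - in the linear case g has no x^2 term, because of a Lyapunov function near
     the origin;
   - g has no x^4 term: otherwise g (x) + g (- x) has a constant sign, and the
     half orbit in x > 0, compared with the mirror image of the one in x < 0,
     cannot close up;
   - in the nilpotent case with f = c x and c^2 >= 8 a3, the region between the
     x-axis and a parabola tangent to it at the origin is trapping. *)

Require Import Defs.
From mathcomp Require Import all_boot all_order all_algebra.
From mathcomp Require Import all_classical all_reals all_analysis.
From mathcomp Require Import complex ring lra.
Set Implicit Arguments.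
Unset Strict Implicit.
Unset Printing Implicit Defensive.
Import Order.TTheory GRing.Theory Num.Theory.
Import numFieldNormedType.Exports.
Local Open Scope classical_set_scope.
Local Open Scope ring_scope.

(** Uniqueness of solutions is used only at equilibria, through a Gronwall estimate: it excludes
    zeros of [g] other than 0, so that [g] has the sign of x. This sign is what the later steps feed
    on.

    Two symmetries leave only one sign of each coefficient to treat: (y, t) -> (- y, - t) replaces f
    by - f, and (x, y) -> (- x, - y) replaces g (x) by - g (- x) and f (x) by f (- x).

    The bound a > -2 is the positivity of x + a x^3 + x^5 at x = 1. The bound 2 sqrt 2 comes from
    the leading part x' = y, y' = - a3 x^3 - c x y: along y = - k x^2 the derivative of y + k x^2 is
    - (2 k^2 - c k + a3) x^3, so a parabola can be a barrier only if 2 k^2 - c k + a3 takes a value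
    <= 0, that is, if c^2 >= 8 a3. Scaling a3 to 1 leaves |c| < 2 sqrt 2. *)

Section Real.
Variable R : realType.
Implicit Types (f h x y : R -> R) (s t a b T : R).

(** * One-sided monotonicity, maxima of periodic functions *)

Lemma is_derive_continuous f t d : is_derive t 1 f d -> {for t, continuous f}.
Proof.
move=> hd; apply: differentiable_continuous; apply/derivable1_diffP.
by case: hd.
Qed.

Lemma near_right (P : R -> Prop) t : (\forall s \near t, P s) -> \forall s \near t^'+, P s.
Proof. exact: cvg_within. Qed.

Lemma near_left (P : R -> Prop) t : (\forall s \near t, P s) -> \forall s \near t^'-, P s.
Proof. exact: cvg_within. Qed.

(** The derivative is known at [t] only. The Caratheodory slope is continuous and positive at [t],
    hence positive nearby, which settles both sides at once. *)
Lemma gt0_is_derive_near f t d : is_derive t 1 f d -> 0 < d ->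
  \forall s \near t, (t < s -> f t < f s) /\ (s < t -> f s < f t).
Proof.
move=> /is_derive1_caratheodory[g [fE cg gt]] d0.
have : \forall s \near t, 0 < g s.
  by apply: (cvgr_gt _ cg); rewrite gt.
apply: filterS => s gs0; split=> st.
  by rewrite -subr_gt0 fE mulr_gt0 // subr_gt0.
by rewrite -subr_lt0 fE pmulr_rlt0 // subr_lt0.
Qed.

Lemma gt0_is_derive_right f t d : is_derive t 1 f d -> 0 < d ->
  \forall s \near t^'+, f t < f s.
Proof.
move=> df d0; have := near_right (gt0_is_derive_near df d0).
by apply: filterS2 (nbhs_right_gt t) => s ts [+ _]; exact.
Qed.

Lemma max_is_derive0 f t d : is_derive t 1 f d ->
  (\forall s \near t, f s <= f t) -> d = 0.
Proof.
move=> df mx; apply/eqP; rewrite eq_le; apply/andP; split; rewrite leNgt; apply/negP => d0.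
  have [s] := @filter_ex _ (t^'+) _ _ (filterI (gt0_is_derive_right df d0) (near_right mx)).
  by move=> [/= + le]; rewrite ltNge le.
have dNf : is_derive t 1 (- f) (- d) by apply: is_derive_eq.
have dN0 : 0 < - d by rewrite oppr_gt0.
have hl := near_left (gt0_is_derive_near dNf dN0).
 have [s] := @filter_ex _ (t^'-) _ _ (filterI (nbhs_left_lt t) (filterI hl (near_left mx))).
by move=> [/= st [[_ /(_ st)] + le]]; rewrite /= ltrN2 ltNge le.
Qed.

Lemma periodic_reduce T t : 0 < T -> exists k : int,
  0 <= t + k%:~R * T < T.
Proof.
move=> T0; exists (- Num.floor (t / T)).
have /andP[h1 h2] := Num.Theory.floor_itv (t / T).
rewrite intrN mulNr subr_ge0 -ler_pdivlMr // h1 /= ltrBlDl.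
by move: h2; rewrite intrD ltr_pdivrMr // mulrDl mul1r.
Qed.

Lemma periodicz h T (k : int) t : periodic h T -> h (t + k%:~R * T) = h t.
Proof.
move=> ph; case: k => n; first by rewrite -pmulrn mulr_natl periodicn.
by rewrite NegzE intrN mulNr -pmulrn mulr_natl -[in RHS](subrK (T *+ n.+1) t) periodicn.
Qed.

Lemma periodic_max h T (D : set R) : 0 < T -> periodic h T -> continuous h ->
  closed D -> (forall t (k : int), D t -> D (t + k%:~R * T)) -> D !=set0 ->
  exists2 c, D c & forall t, D t -> h t <= h c.
Proof.
move=> T0 ph ch cD pD [t0 Dt0].
have [k0 /andP[k01 k02]] := periodic_reduce t0 T0.
have [|||c cD' cmax] := @compact_EVT_max _ _ h (D `&` `[0, T]).
- by exists (t0 + k0%:~R * T); split; [exact: pD | rewrite /= in_itv/= k01 ltW].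
- by rewrite setIC; apply: compact_closedI => //; exact: segment_compact.
- exact: continuous_subspaceT.
exists c; first by move: cD'; rewrite inE => -[].
move=> t Dt; have [k /andP[k1 k2]] := periodic_reduce t T0.
rewrite -(periodicz k t ph); apply: cmax; rewrite inE; split; first exact: pD.
by rewrite /= in_itv/= k1 ltW.
Qed.

(** Form taken by the trapping arguments: [D] is the set of times spent in the region, and a maximum
    of [h] over [D] cannot be improved. It is enough to find one better time for each time, so
    invariance of the region under the flow need not be proved. *)
Lemma periodic_trap h T (D : set R) : 0 < T -> periodic h T -> continuous h ->
  closed D -> (forall t (k : int), D t -> D (t + k%:~R * T)) ->
  (forall t, D t -> exists2 s, D s & h t < h s) -> forall t, ~ D t.
Proof.
move=> T0 ph ch cD pD up t Dt.
have [|c Dc cmax] := periodic_max T0 ph ch cD pD; first by exists t.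
by have [s Ds] := up _ Dc; rewrite ltNge cmax.
Qed.

Lemma closed_ge0 h : continuous h -> closed [set t | 0 <= h t].
Proof.
move=> ch; apply: (@closed_comp _ _ h [set u | 0 <= u]) => //.
Qed.

Lemma is_derive_ge0_le f (df : R -> R) a b : a <= b ->
  (forall s, a < s < b -> is_derive s 1 f (df s)) ->
  {within `[a, b], continuous f} ->
  (forall s, a < s < b -> 0 <= df s) -> f a <= f b.
Proof.
rewrite le_eqVlt => /predU1P[-> //|ab] fdf cf df0.
have [c cab] := MVT ab (fun s sab => fdf s sab) cf.
by move=> e; rewrite -subr_ge0 e; apply: mulr_ge0; [exact: df0 | rewrite subr_ge0 ltW].
Qed.

Lemma is_derive_gt0_lt f (df : R -> R) a b : a < b ->
  (forall s, a < s < b -> is_derive s 1 f (df s)) ->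
  {within `[a, b], continuous f} ->
  (forall s, a < s < b -> 0 < df s) -> f a < f b.
Proof.
move=> ab fdf cf df0; have [c cab] := MVT ab (fun s sab => fdf s sab) cf.
by move=> e; rewrite -subr_gt0 e; apply: mulr_gt0; [exact: df0 | rewrite subr_gt0].
Qed.

(** * Closed orbits of a system with restoring force g and damping f *)

Definition closed_orbit (g f x y : R -> R) T :=
  [/\ 0 < T, periodic x T, periodic y T,
      forall t, is_derive t 1 x (y t) &
      forall t, is_derive t 1 y (- g (x t) - f (x t) * y t)].

Section Orbit.
Variables (g f x y : R -> R) (T : R).
Hypothesis orb : closed_orbit g f x y T.

Let T0 : 0 < T. Proof. by case: orb. Qed.
Let px : periodic x T. Proof. by case: orb. Qed.
Let py : periodic y T. Proof. by case: orb. Qed.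

Lemma orbit_dx t : is_derive t 1 x (y t). Proof. by case: orb. Qed.
Lemma orbit_dy t : is_derive t 1 y (- g (x t) - f (x t) * y t).
Proof. by case: orb. Qed.

Lemma orbit_cx : continuous x.
Proof. by move=> t; exact: is_derive_continuous (orbit_dx t). Qed.
Lemma orbit_cy : continuous y.
Proof. by move=> t; exact: is_derive_continuous (orbit_dy t). Qed.

Let dx := orbit_dx.
Let dy := orbit_dy.

Lemma orbit_max (W : R -> R -> R) (D : set R) :
  continuous (fun t => W (x t) (y t)) -> closed D ->
  (forall t (k : int), D t -> D (t + k%:~R * T)) -> D !=set0 ->
  exists2 c, D c & forall t, D t -> W (x t) (y t) <= W (x c) (y c).
Proof.
by apply: (@periodic_max _ T) => // t; rewrite px py.
Qed.

Lemma orbit_trap (C : R -> R -> Prop) : closed [set t | C (x t) (y t)] ->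
  (forall t, C (x t) (y t) -> exists2 s, C (x s) (y s) & x t < x s) ->
  forall t, ~ C (x t) (y t).
Proof.
move=> cC up; apply: (periodic_trap T0 px orbit_cx cC) => // t k /=.
by rewrite !periodicz.
Qed.

Lemma orbit_bounded (k : R -> R) : continuous k ->
  exists2 M, 0 <= M & forall t, `|k (x t)| <= M.
Proof.
move=> ck; have [||||c _ cmax] := @orbit_max (fun u _ => `|k u|) setT.
- move=> t; apply: cvg_norm; apply: continuous_comp; last exact: ck.
  exact: orbit_cx.
- exact: closedT.
- by [].
- by exists 0.
- by exists `|k (x c)| => // t; exact: cmax.
Qed.

(** Gronwall: the squared distance [N] to the equilibrium satisfies N' <= C N. The constants exist
    because the orbit is bounded. The estimate covers t >= 0, and periodicity gives the other
    times. *)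
Lemma orbit_at_equilibrium (x0 : R) (q : R -> R) : continuous q -> continuous f ->
  (forall u, g u = q u * (u - x0)) -> x 0 = x0 -> y 0 = 0 ->
  forall t, x t = x0 /\ y t = 0.
Proof.
move=> cq cf gE xx0 y0.
have [K K0 qK] := orbit_bounded cq; have [F F0 fF] := orbit_bounded cf.
pose N t := (x t - x0) ^+ 2 + y t ^+ 2.
(* With u = x - x0 and v = y, N' = 2 (1 - q) u v - 2 f v^2. The first term is at most (1 + K) N and
   the second at most 2 F N. *)
pose C := 1 + K + 2 * F.
have dN t : is_derive t 1 (fun t => - (N t * expR (- (C * t))))
   (expR (- (C * t)) * (C * N t - (2 * (x t - x0) * y t + 2 * y t * (- g (x t) - f (x t) * y t)))).
  have := dx t; have := dy t => dxt dyt.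
  rewrite /N; apply: is_derive_eq; rewrite /GRing.scale/=.
  by ring.
have N0 t : 0 <= t -> N t = 0.
  move=> t0; apply/eqP; rewrite eq_le; apply/andP; split; last by rewrite /N addr_ge0 // sqr_ge0.
  have : - (N 0 * expR (- (C * 0))) <= - (N t * expR (- (C * t))).
    apply: (is_derive_ge0_le t0 (fun s _ => dN s)).
      by apply: continuous_subspaceT => s; exact: is_derive_continuous (dN s).
    move=> s _; apply: mulr_ge0; first exact: expR_ge0.
    rewrite gE; move: (qK s) (fF s); rewrite /N /C.
    set u := x s - x0; set v := y s; set a := q _; set b := f _.
    rewrite !ler_norml => /andP[a1 a2] /andP[b1 b2].
    have : 0 <= (K - a) * (u - v) ^+ 2 by rewrite mulr_ge0 ?sqr_ge0 ?subr_ge0.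
    have : 0 <= (K + a) * (u + v) ^+ 2 by rewrite mulr_ge0 ?sqr_ge0 // -lerBlDl sub0r.
    have : 0 <= (F + b) * v ^+ 2 by rewrite mulr_ge0 ?sqr_ge0 // -lerBlDl sub0r.
    have : 0 <= F * u ^+ 2 by rewrite mulr_ge0 ?sqr_ge0.
    have : 0 <= (u - v) ^+ 2 by rewrite sqr_ge0.
    nra.
  rewrite {1}/N xx0 y0 subrr expr0n /= addr0 mul0r oppr0 oppr_ge0.
  by rewrite pmulr_lle0 // expR_gt0.
have Nz t : N t = 0.
  have [k /andP[k0 _]] := periodic_reduce t T0.
  by rewrite -(N0 _ k0) /N !periodicz.
move=> t; move: (Nz t) => /eqP; rewrite /N paddr_eq0 ?sqr_ge0 // !sqrf_eq0 subr_eq0.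
by move=> /andP[/eqP -> /eqP ->].
Qed.

End Orbit.

(** Unlike in [gt0_is_derive_right], the derivative may vanish at [t] itself, as x' = y does when an
    orbit leaves the x-axis. *)
Lemma is_derive_right_lt f (df : R -> R) t : (forall s, is_derive s 1 f (df s)) ->
  (\forall s \near t^'+, 0 < df s) -> \forall s \near t^'+, f t < f s.
Proof.
move=> fdf [e /= e0 he]; exists e => //= s ste ts.
apply: (is_derive_gt0_lt ts (fun u _ => fdf u)).
  by apply: continuous_subspaceT => u; exact: is_derive_continuous (fdf u).
move=> u /andP[tu us]; apply: he => //=; move: ste.
by rewrite /= !ltr_distl => /andP[h _]; lra.
Qed.

(** * Systems all of whose orbits are closed: symmetries and sign of g *)

Lemma orbit_reverse (g f x y : R -> R) (T : R) :
  closed_orbit g f x y T ->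
  closed_orbit g (fun u => - f u) (fun t => x (- t)) (fun t => - y (- t)) T.
Proof.
move=> [T0 px py dx dy]; split => //.
- by move=> u; rewrite -[LHS]px opprD subrK.
- by move=> u; rewrite -[in LHS]py opprD subrK.
- move=> u; have dxu := dx (- u).
  have du : is_derive u 1 (fun u => - u : R) (-1) by apply: is_derive_eq.
  by rewrite -[- _]mulrN1; exact: (is_derive1_comp dxu du).
- move=> u; have dyu := dy (- u).
  have du : is_derive u 1 (fun u => - u : R) (-1) by apply: is_derive_eq.
  by apply: (is_derive_eq (is_deriveN (is_derive1_comp dyu du))); ring.
Qed.

(** All that is retained of a global center at the origin. Arbitrary functions replace polynomials
    so that the class is visibly stable under reversal and reflection; the last clause excludes
    constant solutions. *)
Definition all_closed (g f : R -> R) := forall x0 y0 : R,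
  (x0 != 0) || (y0 != 0) -> exists x y T,
  [/\ closed_orbit g f x y T, x 0 = x0, y 0 = y0,
      forall t, (x t != 0) || (y t != 0) &
      exists t, (x t != x0) || (y t != y0)].

Lemma all_closed_reverse (g f : R -> R) :
  all_closed g f -> all_closed g (fun u => - f u).
Proof.
move=> A x0 y0 h0.
have [|x [y [T [orb ex ey nz [t nt]]]]] := A x0 (- y0).
  by rewrite oppr_eq0.
exists (fun t => x (- t)), (fun t => - y (- t)), T; split.
- exact: orbit_reverse.
- by rewrite oppr0.
- by rewrite oppr0 ey opprK.
- by move=> u; rewrite oppr_eq0.
- by exists (- t); rewrite opprK eqr_oppLR.
Qed.

Lemma all_closed_mirror (g f : R -> R) :
  all_closed g f -> all_closed (fun u => - g (- u)) (fun u => f (- u)).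
Proof.
move=> A x0 y0 h0; have [|x [y [T [[T0 px py dx dy] ex ey nz [t nt]]]]] := A (- x0) (- y0).
  by rewrite !oppr_eq0.
exists (fun t => - x t), (fun t => - y t), T; split.
- split => //.
  + by move=> u; rewrite px.
  + by move=> u; rewrite py.
  + by move=> u; have dxu := dx u; apply: is_derive_eq.
  + move=> u; have dyu := dy u; apply: is_derive_eq.
    by rewrite !opprK; ring.
- by rewrite ex opprK.
- by rewrite ey opprK.
- by move=> u; rewrite !oppr_eq0.
- by exists t; rewrite !eqr_oppLR.
Qed.

Lemma all_closed_no_equilibrium (g f q : R -> R) (x0 : R) : all_closed g f ->
  continuous q -> continuous f -> (forall u, g u = q u * (u - x0)) -> x0 = 0.
Proof.
move=> A cq cf gE; apply/eqP; rewrite -[_ == _]negbK; apply/negP => x00.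
have [|x [y [T [orb ex ey nz [t]]]]] := A x0 0; first by rewrite x00.
by have [-> ->] := orbit_at_equilibrium orb cq cf gE ex ey t; rewrite !eqxx.
Qed.

(** If [g u <= 0] at some u > 0, then g < 0 on all of [u, +oo[, and the quadrant x >= u, y >= 0 is
    trapping: on its lower edge y' = - g > 0, and x increases inside. *)
Lemma all_closed_restoring (g f : R -> R) : all_closed g f -> continuous g ->
  (forall u, u != 0 -> g u != 0) -> forall u, 0 < u -> 0 < g u.
Proof.
move=> A cg gn0 u u0; rewrite ltNge; apply/negP => gu.
have {}gu : g u < 0 by rewrite lt_neqAle gu andbT gn0 // gt_eqF.
have gneg v : u <= v -> g v < 0.
  move=> uv; rewrite ltNge; apply/negP => gv.
  have [|c] := @IVT _ g u v 0 uv (continuous_subspaceT cg).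
    by rewrite ge_min (ltW gu) /= le_max gv orbT.
  rewrite in_itv /= => /andP[uc _] /eqP; apply/negP/gn0.
  by rewrite gt_eqF // (lt_le_trans u0).
have [|x [y [T [orb ex ey _ _]]]] := A u 0; first by rewrite gt_eqF.
have cx := orbit_cx orb; have cy := orbit_cy orb.
apply: (@orbit_trap _ _ _ _ _ orb (fun a b => 0 <= a - u /\ 0 <= b) _ _ 0).
- apply: (@closedI _ [set t | 0 <= x t - u] [set t | 0 <= y t]); apply: closed_ge0 => // t.
  by apply: cvgB; [exact: cx|exact: cvg_cst].
- move=> t [xt yt].
  have yr : \forall s \near t^'+, 0 < y s.
    move: yt; rewrite le_eqVlt => /predU1P[yt|yt]; last first.
      by apply: near_right; apply: (cvgr_gt _ (cy t)).
    have dyt : 0 < - g (x t) - f (x t) * y t.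
      by rewrite -yt mulr0 subr0 oppr_gt0 gneg // -subr_ge0.
    by have := gt0_is_derive_right (orbit_dy orb t) dyt; rewrite -yt.
  have xr := is_derive_right_lt (orbit_dx orb) yr.
  have [s [xs ys]] := @filter_ex _ (t^'+) _ _ (filterI xr yr).
  by exists s => //; split; [apply: (le_trans xt); rewrite lerB // ltW | exact: ltW].
- by rewrite ex ey subrr.
Qed.

(** * Damping of degree at least 3 *)

Lemma all_closed_barrier (g f : R -> R) (K : R) : all_closed g f -> 0 < K ->
  ~ (forall u v, K <= u -> v = u ^+ 3 -> 0 < - g u - f u * v - 3 * u ^+ 2 * v).
Proof.
move=> A K0 H.
have [|x [y [T [orb ex ey _ _]]]] := A K (K ^+ 3); first by rewrite gt_eqF.
have cx := orbit_cx orb; have cy := orbit_cy orb.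
have dh t : is_derive t 1 (fun t => y t - x t ^+ 3)
    (- g (x t) - f (x t) * y t - 3 * x t ^+ 2 * y t).
  have := orbit_dx orb t; have := orbit_dy orb t => dy dx.
  by apply: is_derive_eq; rewrite /GRing.scale /=; ring.
have ch : continuous (fun t => y t - x t ^+ 3).
  by move=> t; exact: is_derive_continuous (dh t).
apply: (@orbit_trap _ _ _ _ _ orb (fun a b => 0 <= a - K /\ 0 <= b - a ^+ 3) _ _ 0).
- apply: (@closedI _ [set t | 0 <= x t - K] [set t | 0 <= y t - x t ^+ 3]);
    apply: closed_ge0 => // t.
  by apply: cvgB; [exact: cx|exact: cvg_cst].
- move=> t [xt yt].
  have xK : K <= x t by rewrite -subr_ge0.
  have yt0 : 0 < y t.
    by rewrite -subr_ge0 in yt; apply: (lt_le_trans (exprn_gt0 3 (lt_le_trans K0 xK))); lra.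
  have hr : \forall s \near t^'+, 0 < y s - x s ^+ 3.
    move: yt; rewrite le_eqVlt => /predU1P[yt|yt]; last first.
      by apply: near_right; apply: (cvgr_gt _ (ch t)).
    have yt' : y t = x t ^+ 3 by apply/eqP; rewrite -subr_eq0 -yt.
    by have := gt0_is_derive_right (dh t) (H _ _ xK yt'); rewrite -yt.
  have xr := gt0_is_derive_right (orbit_dx orb t) yt0.
  have [s [xs ys]] := @filter_ex _ (t^'+) _ _ (filterI xr hr).
  by exists s => //; split; [apply: (le_trans xt); rewrite lerB // ltW | exact: ltW].
- by rewrite ex ey !subrr.
Qed.

(** The exponent 3 of the barrier makes g and the slope term 3 u^2 v both of order u^5, while - f v
    is of order at least u^6 and wins. *)
Lemma all_closed_growth (g f : R -> R) (c C C' : R) k : all_closed g f ->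
  0 < c -> (2 <= k)%N ->
  (forall u, 1 <= u -> c * u ^+ k.+1 - C' * u ^+ k <= - f u) ->
  ~ (forall u, 1 <= u -> g u <= C * u ^+ 5).
Proof.
move=> A c0 k2 hf hg.
(* Beyond [K], - f is at least u^2 (|C| + 4): |C| pays for g, 3 for the slope of the barrier, and 1
   is left for strictness. *)
pose K := 1 + (`|C| + `|C'| + 4) / c.
have K1 : 1 <= K by rewrite /K lerDl divr_ge0 // ltW.
apply: (all_closed_barrier A (lt_le_trans ltr01 K1)) => u v Ku ->.
have u1 := le_trans K1 Ku; have u0 := lt_le_trans ltr01 u1.
have cu : `|C| + `|C'| + 4 <= c * u.
  rewrite -ler_pdivrMl // mulrC; apply: le_trans Ku; rewrite /K; lra.
have h1 : c * u ^+ k.+1 - C' * u ^+ k >= u ^+ 2 * (`|C| + 4).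
  have -> : c * u ^+ k.+1 - C' * u ^+ k = u ^+ k * (c * u - C').
    by rewrite exprSr; ring.
  apply: (@le_trans _ _ (u ^+ k * (`|C| + 4))).
    by rewrite ler_wpM2r ?addr_ge0 // ler_weXn2l.
  apply: ler_wpM2l; first by rewrite exprn_ge0 // ltW.
  have := ler_norm C'; lra.
have h2 := hg _ u1; have h3 := hf _ u1.
have h4 : C * u ^+ 5 <= `|C| * u ^+ 5.
  by apply: ler_wpM2r; [rewrite exprn_ge0 // ltW | exact: ler_norm].
have h5 : u ^+ 2 * (`|C| + 4) * u ^+ 3 <= - f u * u ^+ 3.
  by apply: ler_wpM2r; [rewrite exprn_ge0 // ltW | exact: (le_trans h1)].
have h6 : 0 < u ^+ 5 by rewrite exprn_gt0.
have e5 : u ^+ 2 * (`|C| + 4) * u ^+ 3 = `|C| * u ^+ 5 + 4 * u ^+ 5 by ring.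
have e3 : 3 * u ^+ 2 * u ^+ 3 = 3 * u ^+ 5 by ring.
rewrite e3; move: h5; rewrite e5; lra.
Qed.

(** * Quadratic damping and a Lyapunov function near infinity *)

Lemma bounded_on_segment (h : R -> R) (X : R) : continuous h ->
  exists2 M, 0 < M & forall u, `|u| <= X -> `|h u| <= M.
Proof.
move=> ch; have [X0|X0] := ltP X 0.
  by exists 1 => // u; have := normr_ge0 u; lra.
have [||c _ cmax] := @EVT_max _ (fun u => `|h u|) (- X) X.
- by rewrite ge0_cp.
- by apply: continuous_subspaceT => u; apply: cvg_norm; exact: ch.
exists (`|h c| + 1); first by rewrite ltr_wpDl.
move=> u uX; apply: (le_trans (cmax u _)); last by rewrite lerDl.
by rewrite in_itv /= -ler_norml.
Qed.

Lemma near_infinity_gt0 (k : R -> R) : {for 0, continuous k} -> 0 < k 0 ->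
  exists2 X, 0 < X & forall u, X < `|u| -> 0 < k u^-1.
Proof.
move=> ck k0; have : \forall z \near 0, 0 < k z by apply: (cvgr_gt _ ck).
move=> [e /= e0 he]; exists e^-1; first by rewrite invr_gt0.
move=> u eu; have u0 : 0 < `|u| by apply: lt_trans eu; rewrite invr_gt0.
apply: he; rewrite /ball_ /= sub0r normrN normfV invf_plt ?posrE //.
Qed.

(* For h = f - psi', the derivative of (y + psi)^2 / 2 + G along the field is
   - (psi g + psi h y + h y^2), and h psi (4 g - psi h) is minus the discriminant
   of this form in y.  The term - u of psi keeps h positive where f is negative,
   and e is small enough to make 4 a5 - e (b2 - 3 e) positive. *)
Lemma quadratic_damping_discriminant (a1 a2 a3 a4 a5 b1 b2 : R) : 0 < a5 -> 0 < b2 ->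
  let g u := a1 * u + a2 * u ^+ 2 + a3 * u ^+ 3 + a4 * u ^+ 4 + a5 * u ^+ 5 in
  let e := b2 * a5 / (6 * (a5 + b2 ^+ 2)) in
  let psi u := e * u ^+ 3 + b1 / 2 * u ^+ 2 - u in
  let h u := (b2 - 3 * e) * u ^+ 2 + 1 in
  (forall u, 1 <= h u) /\
  exists2 X, 0 < X & forall u, X < `|u| -> 0 < psi u * (4 * g u - psi u * h u).
Proof.
move=> a50 b20 g e psi h.
have den : 0 < a5 + b2 ^+ 2 by rewrite addr_gt0 // exprn_gt0.
have e0 : 0 < e by rewrite divr_gt0 ?mulr_gt0.
have eE : e * (6 * (a5 + b2 ^+ 2)) = b2 * a5.
  by rewrite /e divfK // mulf_neq0 // gt_eqF.
have e1 : 3 * e < b2.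
  have h1 : 0 < b2 ^+ 3 by rewrite exprn_gt0.
  have h2 : 0 < b2 * a5 by rewrite mulr_gt0.
  rewrite -(ltr_pM2r den) -(ltr_pM2l (_ : 0 < 2)) //.
  have -> : 2 * (3 * e * (a5 + b2 ^+ 2)) = b2 * a5 by rewrite -eE; ring.
  have -> : 2 * (b2 * (a5 + b2 ^+ 2)) = 2 * (b2 * a5) + 2 * b2 ^+ 3 by ring.
  lra.
have e2 : e * (b2 - 3 * e) < 4 * a5.
  have h3 : e * (b2 - 3 * e) <= e * b2 by rewrite ler_pM2l //; lra.
  apply: le_lt_trans h3 _; rewrite -(ltr_pM2r den).
  have h1 : 0 < b2 ^+ 2 * a5 by rewrite mulr_gt0 // exprn_gt0.
  have h2 : 0 < a5 ^+ 2 by rewrite exprn_gt0.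
  have -> : e * b2 * (a5 + b2 ^+ 2) = b2 ^+ 2 * a5 / 6.
    by rewrite expr2 -[b2 * b2 * a5]mulrA -eE; field.
  have -> : 4 * a5 * (a5 + b2 ^+ 2) = 4 * a5 ^+ 2 + 4 * (b2 ^+ 2 * a5) by ring.
  lra.
split.
  by move=> u; rewrite /h lerDr mulr_ge0 ?sqr_ge0 // subr_ge0 ltW.
(* The product has degree 3 + 5 in u; [k] is its quotient by u^8 written in z = 1 / u, and k 0 = e
   (4 a5 - e (b2 - 3 e)). *)
pose k z := (e + b1 / 2 * z - z ^+ 2) *
   (4 * (a1 * z ^+ 4 + a2 * z ^+ 3 + a3 * z ^+ 2 + a4 * z + a5)
     - (e + b1 / 2 * z - z ^+ 2) * ((b2 - 3 * e) + z ^+ 2)).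
have [||X0 X00 hX] := @near_infinity_gt0 k.
- by apply: is_derive_continuous; rewrite /k; apply: is_derive_eq.
- rewrite /k !expr0n /= !mulr0 !addr0 !subr0 !add0r mulr_gt0 // subr_gt0 //.
exists X0 => // u uX; have u0 : u != 0.
  by rewrite -normr_gt0 (lt_trans X00).
have -> : psi u * (4 * g u - psi u * h u) = u ^+ 8 * k u^-1.
  by rewrite /psi /g /h /k; field.
rewrite mulr_gt0 ?hX //.
by rewrite lt_def expf_neq0 //= (exprM u 2 4) exprn_ge0 // sqr_ge0.
Qed.

Definition quintic (a1 a2 a3 a4 a5 u : R) : R :=
  a1 * u + a2 * u ^+ 2 + a3 * u ^+ 3 + a4 * u ^+ 4 + a5 * u ^+ 5.

Definition quintic_prim (a1 a2 a3 a4 a5 u : R) : R :=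
  a1 / 2 * u ^+ 2 + a2 / 3 * u ^+ 3 + a3 / 4 * u ^+ 4 + a4 / 5 * u ^+ 5
    + a5 / 6 * u ^+ 6.

Lemma is_derive_quintic_prim (a1 a2 a3 a4 a5 : R) (x : R -> R) (t d : R) :
  is_derive t 1 x d ->
  is_derive t 1 (fun t => quintic_prim a1 a2 a3 a4 a5 (x t))
    (quintic a1 a2 a3 a4 a5 (x t) * d).
Proof.
move=> dx; rewrite /quintic_prim /quintic; apply: is_derive_eq.
by rewrite /GRing.scale /=; field.
Qed.

Lemma continuous_quintic (a1 a2 a3 a4 a5 : R) : continuous (quintic a1 a2 a3 a4 a5).
Proof.
by move=> u; apply: is_derive_continuous; rewrite /quintic; apply: is_derive_eq.
Qed.

(** Dividing by h >= 1 gives v^2 <= M^2 + M |v|, a bound that does not depend on h. *)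
Lemma quadratic_form_zero_bound (h p g v M : R) : 1 <= h ->
  `|p| <= M -> `|g| <= M -> p * g + p * h * v + h * v ^+ 2 = 0 -> `|v| <= 2 * M.
Proof.
move=> h1 pM gM Q0; rewrite leNgt; apply/negP => vM.
have v0 := normr_ge0 v; have p0 := normr_ge0 p; have g0 := normr_ge0 g.
have h0 : 0 <= h by lra.
have M0 : 0 <= M by lra.
have e1 : h * `|v| ^+ 2 <= `|p| * `|g| + h * (`|p| * `|v|).
  have -> : h * `|v| ^+ 2 = - (p * g + p * h * v).
    by rewrite real_normK ?num_real //; lra.
  have -> : h * (`|p| * `|v|) = `|p * h * v|.
    by rewrite !normrM (ger0_norm h0); ring.
  by rewrite -normrM; apply: le_trans (ler_norm _) _; rewrite normrN ler_normD.
have e2 : `|p| * `|g| <= h * (M * M).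
  by apply: le_trans (ler_pM p0 g0 pM gM) _; rewrite ler_peMl // mulr_ge0.
have e3 : h * (`|p| * `|v|) <= h * (M * `|v|).
  by rewrite ler_wpM2l // ler_wpM2r.
have : h * `|v| ^+ 2 <= h * (M * M + M * `|v|) by rewrite mulrDr; lra.
rewrite ler_pM2l; last by lra.
by nra.
Qed.

(** The derivative of [W] along an orbit is [- Q], and the zeros of [Q] lie in a fixed box. So the
    maximum of [W] on any closed orbit is at most its bound [W0] on the box, which fails for an
    orbit starting high on the y-axis. *)
Lemma all_closed_quadratic_damping (a1 a2 a3 a4 a5 b1 b2 : R) :
  all_closed (quintic a1 a2 a3 a4 a5) (fun u => b1 * u + b2 * u ^+ 2) ->
  0 < a5 -> ~ 0 < b2.
Proof.
move=> A a50 b20.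
have [h1] := quadratic_damping_discriminant a1 a2 a3 a4 b1 a50 b20.
set e := b2 * a5 / _ => -[X X0 hX].
pose psi u := e * u ^+ 3 + b1 / 2 * u ^+ 2 - u.
pose h u := (b2 - 3 * e) * u ^+ 2 + 1.
pose g := quintic a1 a2 a3 a4 a5.
pose G := quintic_prim a1 a2 a3 a4 a5.
pose Q u v := psi u * g u + psi u * h u * v + h u * v ^+ 2.
have cpsi : continuous psi.
  by move=> u; apply: is_derive_continuous; rewrite /psi; apply: is_derive_eq.
have cg : continuous g by exact: continuous_quintic.
have cG : continuous G.
  by move=> u; apply: is_derive_continuous; rewrite /G /quintic_prim; apply: is_derive_eq.
have [P P0 hP] := bounded_on_segment X cpsi.
have [L L0 hL] := bounded_on_segment X cg.
have [N N0 hN] := bounded_on_segment X cG.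
pose M := P + L.
have Qbox u v : Q u v = 0 -> `|u| <= X /\ `|v| <= 2 * M.
  move=> Q0; have hu1 := h1 u; rewrite -/(h u) in hu1.
  have uX : `|u| <= X.
    rewrite leNgt; apply/negP => /hX; rewrite -/(h u) -/(psi u) -/(g u).
    have : 4 * h u * Q u v = 0 by rewrite Q0 mulr0.
    have -> : 4 * h u * Q u v = (2 * h u * v + psi u * h u) ^+ 2 +
        h u * (psi u * (4 * g u - psi u * h u)) by rewrite /Q; ring.
    move=> E p0; have : 0 < h u * (psi u * (4 * g u - psi u * h u)).
      by rewrite mulr_gt0 //; lra.
    by have := sqr_ge0 (2 * h u * v + psi u * h u); lra.
  have pM : `|psi u| <= M by apply: le_trans (hP _ uX) _; rewrite lerDl ltW.
  have gM : `|g u| <= M by apply: le_trans (hL _ uX) _; rewrite lerDr ltW.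
  by split=> //; exact: quadratic_form_zero_bound Q0.
pose W u v := (v + psi u) ^+ 2 / 2 + G u.
pose W0 := (3 * M) ^+ 2 / 2 + N.
have Wbox u v : `|u| <= X -> `|v| <= 2 * M -> W u v <= W0.
  move=> uX vM; rewrite /W /W0; apply: lerD; last first.
    by apply: le_trans (ler_norm _) (hN _ uX).
  rewrite ler_pM2r //.
  rewrite -ler_sqrt; last by rewrite exprn_ge0 // /M; lra.
  rewrite !sqrtr_sqr (ger0_norm (_ : 0 <= 3 * M)); last by rewrite /M; lra.
  by apply: le_trans (ler_normD _ _) _; have := hP _ uX; rewrite /M in vM *; lra.
have M0 : 0 < M by rewrite /M; lra.
have W00 : 0 < W0.
  by rewrite /W0 addr_gt0 // divr_gt0 // exprn_gt0 // mulr_gt0.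
(* At the starting point psi and G vanish, so W 0 Y = Y^2 / 2, and (W0 + 2)^2 / 2 > W0. *)
pose Y := W0 + 2.
have [|x [y [T [orb ex ey _ _]]]] := A 0 Y.
  by apply/orP; right; rewrite gt_eqF // /Y; lra.
have dW t : is_derive t 1 (fun t => W (x t) (y t)) (- Q (x t) (y t)).
  have dx := orbit_dx orb t; have dy := orbit_dy orb t.
  have dG := is_derive_quintic_prim a1 a2 a3 a4 a5 dx.
  rewrite /W /G /psi; apply: is_derive_eq.
  by rewrite /GRing.scale /= /Q /psi /h /g; field.
have [|||c _ cmax] := orbit_max orb (W := W) _ (@closedT _) _ _ => //.
- by move=> t; exact: is_derive_continuous (dW t).
- by exists 0.
have : - Q (x c) (y c) = 0.
  by apply: (max_is_derive0 (dW c)); apply: filterE => s; exact: cmax.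
move=> /eqP; rewrite oppr_eq0 => /eqP /Qbox[uX vM].
have := Wbox _ _ uX vM; have := cmax 0 I.
rewrite ex ey /W /G /psi /quintic_prim !expr0n /= !mulr0 !addr0 subr0 addr0.
rewrite -/(psi (x c)) -/(G (x c)) -/(W (x c) (y c)).
have : W0 < Y ^+ 2 / 2 by rewrite /Y; nra.
by lra.
Qed.

(** * Quadratic restoring term in the linear case *)

Definition cvg_origin (F : R -> R -> R) :=
  (fun p : R * R => F p.1 p.2) p @[p --> ((0, 0) : R * R)] --> F 0 0.

Lemma near_origin_gt0 (F : R -> R -> R) : cvg_origin F -> 0 < F 0 0 ->
  \forall p \near ((0, 0) : R * R), 0 < F p.1 p.2.
Proof. by move=> cF F0; exact: (cvgr_gt _ cF). Qed.

Lemma cvg_originC (c : R) : cvg_origin (fun _ _ => c).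
Proof. exact: cvg_cst. Qed.

Lemma cvg_origin_fst : cvg_origin (fun u _ => u).
Proof. exact: cvg_fst. Qed.

Lemma cvg_origin_snd : cvg_origin (fun _ v => v).
Proof. exact: cvg_snd. Qed.

Lemma cvg_originD (F H : R -> R -> R) : cvg_origin F -> cvg_origin H ->
  cvg_origin (fun u v => F u v + H u v).
Proof. by move=> cF cH; apply: (cvgD cF cH). Qed.

Lemma cvg_originN (F : R -> R -> R) : cvg_origin F -> cvg_origin (fun u v => - F u v).
Proof. by move=> cF; apply: (cvgN cF). Qed.

Lemma cvg_originM (F H : R -> R -> R) : cvg_origin F -> cvg_origin H ->
  cvg_origin (fun u v => F u v * H u v).
Proof. by move=> cF cH; apply: (cvgM cF cH). Qed.

Lemma near_origin_box (P : R -> R -> Prop) :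
  (\forall p \near ((0, 0) : R * R), P p.1 p.2) ->
  exists2 r : R, 0 < r & forall u v, `|u| <= r -> `|v| <= r -> P u v.
Proof.
move=> /nbhs_ballP[e /= e0 he]; exists (e / 2); first by rewrite divr_gt0.
move=> u v ur vr; apply: (he (u, v)); split; rewrite /ball /= sub0r normrN; lra.
Qed.

(** Powers of the variables are not covered, hence the Horner forms and explicit products in the
    factors [r], [l1] and [l2] below. *)
Ltac cvg_poly := lazymatch goal with
  | |- cvg_origin (fun _ _ => ?c) => exact: cvg_originC
  | |- cvg_origin (fun u _ => u) => exact: cvg_origin_fst
  | |- cvg_origin (fun _ v => v) => exact: cvg_origin_snd
  | |- cvg_origin (fun u v => @?F u v + @?H u v) =>
      apply: (@cvg_originD F H); cbv beta; cvg_poly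
  | |- cvg_origin (fun u v => @?F u v * @?H u v) =>
      apply: (@cvg_originM F H); cbv beta; cvg_poly
  | |- cvg_origin (fun u v => - @?F u v) => apply: (@cvg_originN F); cbv beta; cvg_poly
  end.

(* With f = b x and c = b / a1, the function G + y / c - ln (1 + c y) / c^2 has
   derivative c y^2 (g - f / c) / (1 + c y), whose leading part is c a2 x^2 y^2.
   W is its truncation at degree 4 in y, and the terms in kp turn that leading
   part into a definite quartic form. *)
Lemma all_closed_quadratic_restoring (a1 a2 a3 a4 a5 b : R) :
  all_closed (quintic a1 a2 a3 a4 a5) (fun u => b * u) ->
  0 < a1 -> b != 0 -> a2 = 0.
Proof.
move=> A a10 b0; apply/eqP/negPn/negP => a20.
pose c := b / a1.
have bE : b = c * a1 by rewrite /c divfK // gt_eqF.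
have c0 : c != 0 by rewrite /c mulf_neq0 // invr_eq0 gt_eqF.
pose sg := c * a2.
have sg0 : 0 < sg ^+ 2 by rewrite exprn_even_gt0 //= mulf_neq0.
(* The correction adds kp (a1 x^4 - 3 (1 + a1) x^2 y^2 + y^4) to the leading part sg x^2 y^2 of the
   derivative. This value of [kp] spends exactly half of [sg] on the mixed term. *)
pose kp := sg / (6 * (1 + a1)).
have kpE : kp * (6 * (1 + a1)) = sg by rewrite /kp divfK // mulf_neq0 // gt_eqF //; lra.
have kp0 : 0 < sg * kp.
  by rewrite /kp mulrA -expr2 divr_gt0 // mulr_gt0 //; lra.
pose r (u : R) := a2 + u * (a3 + u * (a4 + u * a5)).
pose k1 (u v : R) := sg * (kp * (a1 + u * r u + b * v)).
pose k2 (u v : R) := sg * (c * r u * (1 - c * v) - 3 * kp * (a1 + u * r u + b * v + 1)).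
pose k3 (u v : R) := sg * (kp - b * c * c * u).
pose m := Num.min (a1 / 4) (1 / 4).
have m0 : 0 < m by rewrite lt_min !divr_gt0.
pose l1 (u v : R) := a1 / 2 + u * (a2 / 3 + u * (a3 / 4 + u * (a4 / 5 + u * (a5 / 6)))) 
  - kp * u * v - m.
pose l2 (u v : R) := 1 / 2 - c / 3 * v + c * c / 4 * (v * v) + kp * u * v - m.
(* [Q] is sg times the derivative of [W]; the factor makes the three coefficients positive at the
   origin whatever the sign of [sg]. *)
pose Q u v := u ^+ 4 * k1 u v + (u * v) ^+ 2 * k2 u v + v ^+ 4 * k3 u v.
pose G := quintic_prim a1 a2 a3 a4 a5.
pose W u v := G u + v ^+ 2 / 2 - c / 3 * v ^+ 3 + c ^+ 2 / 4 * v ^+ 4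
  + kp * (u * v ^+ 3 - u ^+ 3 * v).
have n1 : \forall p \near ((0, 0) : R * R), 0 < k1 p.1 p.2.
  apply: near_origin_gt0; first by rewrite /k1 /r; cvg_poly.
  by rewrite /k1 !mul0r mulr0 !addr0 mulrA mulr_gt0.
have n2 : \forall p \near ((0, 0) : R * R), 0 < k2 p.1 p.2.
  apply: near_origin_gt0; first by rewrite /k2 /r; cvg_poly.
  have -> : k2 0 0 = sg * (sg - 3 * kp * (a1 + 1)) by rewrite /k2 /r /sg; ring.
  have -> : sg * (sg - 3 * kp * (a1 + 1)) = sg ^+ 2 / 2 by rewrite -kpE; field.
  by rewrite divr_gt0.
have n3 : \forall p \near ((0, 0) : R * R), 0 < k3 p.1 p.2.
  apply: near_origin_gt0; first by rewrite /k3; cvg_poly.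
  by rewrite /k3 mulr0 subr0.
have n4 : \forall p \near ((0, 0) : R * R), 0 < l1 p.1 p.2.
  apply: near_origin_gt0; first by rewrite /l1; cvg_poly.
  have : m <= a1 / 4 by rewrite ge_min lexx.
  by rewrite /l1 !mul0r !mulr0 !addr0 subr0; lra.
have n5 : \forall p \near ((0, 0) : R * R), 0 < l2 p.1 p.2.
  apply: near_origin_gt0; first by rewrite /l2; cvg_poly.
  have : m <= 1 / 4 by rewrite ge_min lexx orbT.
  by rewrite /l2 !mulr0 !addr0 subr0; lra.
have [rho rho0 box] := near_origin_box
  (P := fun u v => 0 < k1 u v /\ 0 < k2 u v /\ 0 < k3 u v /\ 0 < l1 u v /\ 0 < l2 u v)
  (filterI n1 (filterI n2 (filterI n3 (filterI n4 n5)))).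
have Wlow u v : `|u| <= rho -> `|v| <= rho -> m * (u ^+ 2 + v ^+ 2) <= W u v.
  move=> hu hv; have [_ [_ [_ [p4 p5]]]] := box _ _ hu hv.
  have -> : W u v = m * (u ^+ 2 + v ^+ 2) + u ^+ 2 * l1 u v + v ^+ 2 * l2 u v.
    by rewrite /W /l1 /l2 /G /quintic_prim; field.
  by rewrite -addrA lerDl addr_ge0 // mulr_ge0 ?sqr_ge0 // ltW.
have Qpos u v : `|u| <= rho -> `|v| <= rho -> Q u v = 0 -> u = 0 /\ v = 0.
  move=> hu hv; have [p1 [p2 [p3 _]]] := box _ _ hu hv.
  have q1 : 0 <= u ^+ 4 * k1 u v by rewrite mulr_ge0 ?exprn_even_ge0 // ltW.
  have q2 : 0 <= (u * v) ^+ 2 * k2 u v by rewrite mulr_ge0 ?exprn_even_ge0 // ltW.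
  have q3 : 0 <= v ^+ 4 * k3 u v by rewrite mulr_ge0 ?exprn_even_ge0 // ltW.
  rewrite /Q => Q0.
  have /eqP : u ^+ 4 * k1 u v = 0 by lra.
  rewrite mulf_eq0 (gt_eqF p1) orbF expf_eq0 => /andP[_ /eqP ->].
  have /eqP : v ^+ 4 * k3 u v = 0 by lra.
  by rewrite mulf_eq0 (gt_eqF p3) orbF expf_eq0 => /andP[_ /eqP ->].
have cG : continuous G.
  by move=> u; apply: is_derive_continuous; rewrite /G /quintic_prim; apply: is_derive_eq.
have G0 : G 0 = 0 by rewrite /G /quintic_prim !expr0n /= !mulr0 !addr0.
(* On the boundary of the box [W] is at least m rho^2. Starting below that level forces the minimum
   of [W] over the times spent in the box to be interior, hence a zero of [Q], hence the origin,
   which the orbit avoids. *)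
have [x0 /andP[x00 x0r] Gx0] : exists2 x0, 0 < x0 < rho & G x0 < m * rho ^+ 2.
  have : \forall u \near 0^'+, G u < m * rho ^+ 2.
    by apply: near_right; apply: (cvgr_lt _ (cG 0)); rewrite G0 mulr_gt0 // exprn_gt0.
  move=> hG; have [u [Gu [u0 ur]]] := @filter_ex _ (0^'+) _ _ (filterI hG
    (filterI (nbhs_right_gt 0) (nbhs_right_lt rho0))).
  by exists u => //; apply/andP.
have [|x [y [T [orb ex ey nz _]]]] := A x0 0; first by rewrite gt_eqF.
have dx := orbit_dx orb; have dy := orbit_dy orb.
have dW t : is_derive t 1 (fun t => - W (x t) (y t)) (- (Q (x t) (y t) / sg)).
  have dxt := dx t; have dyt := dy t.
  have dG := is_derive_quintic_prim a1 a2 a3 a4 a5 dxt.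
  rewrite /W /G; apply: is_derive_eq.
  rewrite /GRing.scale /= /Q /k1 /k2 /k3 /r bE /quintic.
  have sgn : sg != 0 by rewrite mulf_neq0.
  by field.
pose D := [set t | 0 <= rho - `|x t|] `&` [set t | 0 <= rho - `|y t|].
have cx := orbit_cx orb; have cy := orbit_cy orb.
have D0 : D 0.
  by split; rewrite /= ?ex ?ey ?normr0 subr_ge0 ?gtr0_norm // ltW.
have [||||c0' [/= xc yc] cmax] := @orbit_max _ _ _ _ _ orb (fun u v => - W u v) D.
- by move=> t; exact: is_derive_continuous (dW t).
- apply: closedI; apply: closed_ge0 => t; apply: cvgB; try exact: cvg_cst;
    apply: cvg_norm; [exact: cx | exact: cy].
- by case: orb => T0 px py _ _ t k [/= h1 h2]; split; rewrite /= periodicz.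
- by exists 0.
rewrite !subr_ge0 in xc yc.
have W0 : W (x c0') (y c0') < m * rho ^+ 2.
  have := cmax _ D0; rewrite lerN2 => /le_lt_trans; apply.
  by rewrite ex ey /W !expr0n /= !mulr0 !mul0r subrr !addr0 mulr0 addr0 subr0.
have low := Wlow _ _ xc yc.
have xc' : `|x c0'| < rho.
  rewrite lt_neqAle xc andbT; apply/eqP => e.
  have h : m * rho ^+ 2 <= m * (x c0' ^+ 2 + y c0' ^+ 2).
    by rewrite ler_pM2l // -e real_normK ?num_real // lerDl sqr_ge0.
  lra.
have yc' : `|y c0'| < rho.
  rewrite lt_neqAle yc andbT; apply/eqP => e.
  have h : m * rho ^+ 2 <= m * (x c0' ^+ 2 + y c0' ^+ 2).
    by rewrite ler_pM2l // -e real_normK ?num_real // lerDr sqr_ge0.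
  lra.
have : - (Q (x c0') (y c0') / sg) = 0.
  apply: (max_is_derive0 (dW c0')).
  have nx : \forall t \near c0', `|x t| < rho.
    by apply: (cvgr_lt _ (cvg_norm (cx c0'))).
  have ny : \forall t \near c0', `|y t| < rho.
    by apply: (cvgr_lt _ (cvg_norm (cy c0'))).
  apply: filterS2 nx ny => t hx hy; apply: cmax.
  by split; rewrite /= subr_ge0 ltW.
move=> /eqP; rewrite oppr_eq0 mulf_eq0 invr_eq0 [sg == 0]mulf_eq0 (negbTE c0) (negbTE a20) !orbF.
move=> /eqP /(Qpos _ _ xc yc)[x1 y1].
by have := nz c0'; rewrite x1 y1 !eqxx.
Qed.

(** * Sign of g, and the bound on the damping in the nilpotent case *)

Lemma all_closed_quintic_sign (a1 a2 a3 a4 a5 : R) (f : R -> R) :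
  all_closed (quintic a1 a2 a3 a4 a5) f -> continuous f ->
  (forall u, 0 < u -> 0 < quintic a1 a2 a3 a4 a5 u) /\
  (forall u, u < 0 -> quintic a1 a2 a3 a4 a5 u < 0).
Proof.
move=> A cf; have cg := @continuous_quintic a1 a2 a3 a4 a5.
have gn0 z : z != 0 -> quintic a1 a2 a3 a4 a5 z != 0.
  apply: contra => /eqP gz.
  (* Quotient of g (u) - g (z) by u - z: a nonzero root z of g would be a second equilibrium. *)
  pose q u := a1 + a2 * (u + z) + a3 * (u ^+ 2 + u * z + z ^+ 2)
    + a4 * (u ^+ 3 + u ^+ 2 * z + u * z ^+ 2 + z ^+ 3)
    + a5 * (u ^+ 4 + u ^+ 3 * z + u ^+ 2 * z ^+ 2 + u * z ^+ 3 + z ^+ 4).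
  apply/eqP/(all_closed_no_equilibrium (q := q) A) => // [u|u].
    by apply: is_derive_continuous; rewrite /q; apply: is_derive_eq.
  by rewrite -[LHS]subr0 -gz /quintic /q; ring.
split; first exact: (all_closed_restoring A).
move=> u u0; rewrite -oppr_gt0 -[u]opprK.
apply: (all_closed_restoring (all_closed_mirror A)); last by rewrite oppr_gt0.
- move=> v; apply: cvgN; apply: continuous_comp; last exact: cg.
  exact: opp_continuous.
- by move=> v v0; rewrite oppr_eq0 gn0 // oppr_eq0.
Qed.

(* h is the height above y = - (b / 4) x^2 + x^3.  The coefficient - b / 4 is
   the one for which a parabola can remain a barrier up to b^2 = 8 a3; the cubic
   term then dominates the quintic part of g. *)
Lemma all_closed_monodromy (a3 a5 b : R) :
  all_closed (quintic 0 0 a3 0 a5) (fun u => b * u) ->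
  0 <= a3 -> 0 < a5 -> 0 < b -> b ^+ 2 < 8 * a3.
Proof.
move=> A a30 a50 b0; rewrite ltNge; apply/negP => le.
(* For 0 < x <= x0 the factor b / 4 - (3 + a5) x of x^4 in h' on the barrier is at least b / 8. Also
   x0 < b / 4, so (x0, 0) lies above the barrier. *)
pose x0 := b / (8 * (3 + a5)).
have x0E : (3 + a5) * x0 = b / 8 by rewrite /x0; field; rewrite gt_eqF //; lra.
have x00 : 0 < x0 by rewrite divr_gt0 // mulr_gt0 //; lra.
have x0b : 3 * x0 <= b / 8.
  have : 0 <= a5 * x0 by rewrite mulr_ge0 // ltW.
  by rewrite -x0E; lra.
have [|x [y [T [orb ex ey nz _]]]] := A x0 0; first by rewrite gt_eqF.
have dx := orbit_dx orb; have dy := orbit_dy orb.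
have cx := orbit_cx orb; have cy := orbit_cy orb.
pose h t := y t + b / 4 * x t ^+ 2 - x t ^+ 3.
pose e t := - quintic 0 0 a3 0 a5 (x t) - b * x t * y t + b / 2 * x t * y t - 3 * x t ^+ 2 * y t.
have dh t : is_derive t 1 h (e t).
  have dxt := dx t; have dyt := dy t; rewrite /h /e; apply: is_derive_eq.
  by rewrite /GRing.scale /=; field.
have ch : continuous h by move=> t; exact: is_derive_continuous (dh t).
have cNx : continuous (fun t => - x t) by move=> t; apply: cvgN; exact: cx.
have cNy : continuous (fun t => - y t) by move=> t; apply: cvgN; exact: cy.
pose D := [set t | 0 <= x t] `&` ([set t | 0 <= x0 - x t] `&`
   ([set t | 0 <= - y t] `&` [set t | 0 <= h t])).
have [T0 px py _ _] := orb.
apply: (@periodic_trap (fun t => - x t) T D _ _ _ _ _ _ 0) => //.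
- by move=> t; rewrite px.
- apply: closedI; first exact: closed_ge0.
  apply: closedI; last by apply: closedI; exact: closed_ge0.
  by apply: closed_ge0 => t; apply: cvgB; [exact: cvg_cst|exact: cx].
- move=> t k [/= h1 [h2 [h3 h4]]].
  by split; [|split; [|split]]; rewrite /= /h !periodicz.
- move=> t [/= xt [xt0 [yt ht]]].
  rewrite subr_ge0 in xt0; rewrite oppr_ge0 in yt.
  (* The region meets x = 0 only at the origin, which the orbit avoids. *)
  have {}xt : 0 < x t.
    rewrite lt_neqAle xt andbT; apply/eqP => xt'.
    have yt' : y t = 0.
      by apply/eqP; rewrite eq_le yt /=; move: ht; rewrite /h -xt' !expr0n /= !mulr0 addr0 subr0.
    by have := nz t; rewrite -xt' yt' !eqxx.
  have x2 : 0 < x t ^+ 2 by rewrite exprn_gt0.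
  have x3 : 0 < x t ^+ 3 by rewrite exprn_gt0.
  have x4 : 0 < x t ^+ 4 by rewrite exprn_gt0.
  have gt : 0 < quintic 0 0 a3 0 a5 (x t).
    rewrite /quintic !mul0r !add0r addr0 ltr_wpDl // ?mulr_ge0 // ?ltW //.
    by rewrite mulr_gt0 // exprn_gt0.
  have yr : \forall s \near t^'+, 0 < - y s.
    move: yt; rewrite le_eqVlt => /predU1P[yt|yt].
      have dN : is_derive t 1 (fun s => - y s) (- (- quintic 0 0 a3 0 a5 (x t) - b * x t * y t)).
        by have dyt := dy t; apply: is_derive_eq.
      have dp : 0 < - (- quintic 0 0 a3 0 a5 (x t) - b * x t * y t).
        by rewrite yt mulr0 subr0 opprK.
      by have := gt0_is_derive_right dN dp; rewrite yt oppr0.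
    by apply: near_right; apply: (cvgr_gt _ (cNy t)); rewrite oppr_gt0.
  have hr : \forall s \near t^'+, 0 < h s.
    move: ht; rewrite le_eqVlt => /predU1P[ht|ht]; last first.
      by apply: near_right; apply: (cvgr_gt _ (ch t)).
    have et : 0 < e t.
      have -> : e t = (b ^+ 2 - 8 * a3) / 8 * x t ^+ 3 + x t ^+ 4 * (b / 4 - (3 + a5) * x t).
        have yE : y t = x t ^+ 3 - b / 4 * x t ^+ 2 by move: ht; rewrite /h; lra.
        by rewrite /e yE /quintic; field.
      have : (3 + a5) * x t <= b / 8 by rewrite -x0E ler_pM2l //; lra.
      move=> h5; apply: ltr_wpDl; first by rewrite mulr_ge0 ?divr_ge0 ?subr_ge0 // ltW.
      by rewrite mulr_gt0 //; lra.
    by have := gt0_is_derive_right (dh t) et; rewrite -ht.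
  have dNx s : is_derive s 1 (fun s => - x s) (- y s).
    by have dxs := dx s; apply: is_derive_eq.
  have xr := is_derive_right_lt dNx yr.
  have xp : \forall s \near t^'+, 0 < x s.
    by apply: near_right; apply: (cvgr_gt _ (cx t)).
  have [s [s1 [s2 [s3 s4]]]] := @filter_ex _ (t^'+) _ _
    (filterI xp (filterI xr (filterI yr hr))).
  rewrite ltrN2 in s2; exists s; last by rewrite ltrN2.
  split; [exact: ltW|split; [|split; exact: ltW]].
  by rewrite /= subr_ge0 (le_trans (ltW s2)).
- split; rewrite /= ?ex; first exact: ltW.
  rewrite subrr; split=> //; rewrite ey oppr0; split=> //=.
  have : 0 <= x0 ^+ 2 * (b / 4 - x0) by apply: mulr_ge0; [exact: sqr_ge0 | lra].
  by rewrite /h ex ey; lra.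
Qed.

(** * Comparison of the half orbits in x > 0 and x < 0 *)

Lemma pos_of_pos_derive (U dU : R -> R) (k z : R) :
  {within `[0, z], continuous U} -> U 0 = 0 ->
  (forall s, 0 < s <= z -> is_derive s 1 U (dU s)) ->
  (forall s, 0 < s <= z -> U s <= 0 -> k * U s < dU s) -> 0 < z -> 0 < U z.
Proof.
move=> cU U0 dUs Upos z0; rewrite ltNge; apply/negP => Uz.
(* With this integrating factor the hypothesis says that Z' > 0 wherever Z <= 0, which is impossible
   at a nonpositive minimum to the right of 0. *)
pose Z s := U s * expR (- (k * s)).
have cZ : {within `[0, z], continuous Z}.
  move=> s; apply: cvgM; first exact: cU.
  have cE : continuous (fun s : R => expR (- (k * s))).
    by move=> t; apply: is_derive_continuous; apply: is_derive_eq.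
  exact: (continuous_subspaceT cE).
have [c] := EVT_min (ltW z0) cZ; rewrite in_itv /= => /andP[c0 cz] cmin.
have [c' /andP[c'0 c'z] [Zc' c'min]] : exists2 c', 0 < c' <= z &
    Z c' <= 0 /\ forall t, t \in `[0, z] -> Z c' <= Z t.
  have Zz : Z z <= 0 by rewrite /Z pmulr_lle0 // expR_gt0.
  have zz : z \in `[0, z] by rewrite in_itv /= (ltW z0) lexx.
  have [c00|c00] := ltP 0 c.
    by exists c; [rewrite c00|split=> //; exact: le_trans (cmin _ zz) Zz].
  have cE : c = 0 by apply/eqP; rewrite eq_le c00.
  (* If the minimum found is at 0, it has value 0 and [Z z <= 0] attains it too. *)
  exists z; first by rewrite z0 lexx.
  split=> // t tz; apply: le_trans Zz _; apply: le_trans (cmin _ tz).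
  by rewrite cE /Z U0 mul0r.
have Uc : U c' <= 0 by move: Zc'; rewrite /Z pmulr_lle0 // expR_gt0.
have cc : 0 < c' <= z by rewrite c'0.
have dZ : is_derive c' 1 Z (expR (- (k * c')) * (dU c' - k * U c')).
  by have dUc := dUs _ cc; apply: is_derive_eq; rewrite /GRing.scale /=; ring.
have Zp : 0 < expR (- (k * c')) * (dU c' - k * U c').
  by rewrite mulr_gt0 ?expR_gt0 // subr_gt0 Upos.
have nl := near_left (gt0_is_derive_near dZ Zp).
have [s [[_ s1] [s2 s3]]] := @filter_ex _ (c'^'-) _ _ (filterI nl
  (filterI (nbhs_left_lt c') (nbhs_left_gt c'0))).
have := s1 s2; rewrite ltNge c'min // in_itv /= (ltW s3) /=.
by apply: le_trans c'z; exact: ltW.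
Qed.

(** While y > 0, x increases, so the arc is the graph of y composed with the inverse of x. Since y
    may vanish at the ends, only continuity is claimed there. *)
Lemma arc_graph (x y dy : R -> R) (t1 t2 : R) : t1 < t2 ->
  (forall t, is_derive t 1 x (y t)) -> (forall t, is_derive t 1 y (dy t)) ->
  (forall t, t1 < t < t2 -> 0 < y t) ->
  x t1 < x t2 /\ exists h : R -> R,
  [/\ h (x t1) = y t1, h (x t2) = y t2, {within `[x t1, x t2], continuous h} &
    forall z, x t1 < z < x t2 -> exists t,
      [/\ x t = z, h z = y t, 0 < y t & is_derive z 1 h (dy t / y t)]].
Proof.
move=> t12 dx dyt ypos.
have cx : continuous x by move=> t; exact: is_derive_continuous (dx t).
have cy : continuous y by move=> t; exact: is_derive_continuous (dyt t).
have wx : {within `[t1, t2], continuous x} by exact: continuous_subspaceT.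
have incr s t : t1 <= s -> s < t -> t <= t2 -> x s < x t.
  move=> t1s st tt2; apply: (is_derive_gt0_lt st (fun u _ => dx u)).
    exact: continuous_subspaceT.
  move=> u /andP[su ut]; apply: ypos.
  by rewrite (le_lt_trans t1s su) (lt_le_trans ut tt2).
have x12 : x t1 < x t2 by apply: incr.
have inj : {in `[t1, t2] &, injective x}.
  move=> s t; rewrite !in_itv /= => /andP[s1 s2] /andP[u1 u2] e.
  have [st|ts|//] := ltgtP s t.
    by have := incr _ _ s1 st u2; rewrite e ltxx.
  by have := incr _ _ u1 ts s2; rewrite e ltxx.
split=> //; pose tau z := xget t1 [set t | t \in `[t1, t2] /\ x t = z].
have K : {in `[t1, t2], cancel x tau}.
  move=> t tt; rewrite /tau; case: xgetP => [s _ [/= ss e]|/(_ t)[]//].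
  exact: inj.
have ctau := segment_can_le_continuous (ltW t12) wx K.
have m1 : t1 \in `[t1, t2] by rewrite in_itv /= lexx ltW.
have m2 : t2 \in `[t1, t2] by rewrite in_itv /= lexx ltW.
exists (y \o tau); split.
- by rewrite /= K.
- by rewrite /= K.
- by apply: within_continuous_comp => // u _; exact: cy.
move=> z /andP[z1 z2].
have [|t] := @IVT _ x t1 t2 z (ltW t12) wx.
  by rewrite (min_idPl (ltW x12)) (max_idPr (ltW x12)) !ltW.
rewrite in_itv /= => /andP[tt1 tt2] xt.
have tt1' : t1 < t.
  by rewrite lt_neqAle tt1 andbT; apply/eqP => e; move: z1; rewrite -xt e ltxx.
have tt2' : t < t2.
  by rewrite lt_neqAle tt2 andbT; apply/eqP => e; move: z2; rewrite -xt e ltxx.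
have yt : 0 < y t by rewrite ypos // tt1'.
have tauz : tau z = t by rewrite -xt K // in_itv /= tt1.
exists t; split=> //; first by rewrite /= tauz.
have nt : \forall s \near t, s \in `]t1, t2[ by apply: near_in_itvoo; rewrite in_itv /= tt1'.
have dtau : is_derive z 1 tau (y t)^-1.
  rewrite -xt; apply: (@is_derive_inverse _ x tau (y t) t).
  - apply: filterS nt => s; rewrite in_itv /= => /andP[s1 s2].
    by apply: K; rewrite in_itv /= !ltW.
  - by apply: filterE => s; exact: cx.
  - by rewrite gt_eqF.
have dyz : is_derive (tau z) 1 y (dy t) by rewrite tauz.
exact: (is_derive1_comp dyz dtau).
Qed.

(** Passing to h^2 removes the division by h in dy / dx, which blows up where the arc meets the
    x-axis. *)
Lemma lienard_arc (g f x y : R -> R) (t1 t2 : R) : t1 < t2 ->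
  (forall t, is_derive t 1 x (y t)) ->
  (forall t, is_derive t 1 y (- g (x t) - f (x t) * y t)) ->
  (forall t, t1 < t < t2 -> 0 < y t) ->
  x t1 < x t2 /\ exists h : R -> R,
  [/\ h (x t1) = y t1, h (x t2) = y t2, {within `[x t1, x t2], continuous h},
    (forall z, x t1 < z < x t2 -> 0 < h z) &
    forall z, x t1 < z < x t2 ->
      is_derive z 1 (fun u => h u ^+ 2) (- 2 * (f z * h z + g z))].
Proof.
move=> t12 dx dy ypos; have [x12 [h [h1 h2 ch H]]] := arc_graph t12 dx dy ypos.
split=> //; exists h; split=> // z /H[t [xt hz yt dh]]; first by rewrite hz.
apply: is_derive_eq; rewrite /GRing.scale /= hz xt.
by field; rewrite gt_eqF.
Qed.

Lemma first_zero (h : R -> R) (a b : R) : continuous h -> a < b ->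
  (\forall s \near a^'+, 0 < h s) -> h b <= 0 ->
  exists c, [/\ a < c, h c = 0 & forall s, a < s < c -> 0 < h s].
Proof.
move=> ch ab [e /= e0 he] hb.
have he' s : a < s -> s < a + e -> 0 < h s.
  by move=> as_ se; apply: he => //; rewrite /ball_ /= ltr_distlC; lra.
(* Dropping an initial stretch where [h] is positive discards a possible zero at [a] and keeps [D]
   compact; the least point of [D] is the zero sought. *)
pose D := [set t | 0 <= - h t] `&` `[a + e / 2, b].
have cNh : continuous (fun t => - h t) by move=> t; apply: cvgN; exact: ch.
have bae : a + e <= b by rewrite leNgt; apply/negP => /(he' _ ab); lra.
have [|||c] := @compact_EVT_min _ _ id D.
- by exists b; split; rewrite /= ?oppr_ge0 // in_itv /=; lra.
- rewrite /D setIC; apply: compact_closedI; first exact: segment_compact.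
  exact: closed_ge0.
- by apply: continuous_subspaceT => t; exact: cvg_id.
rewrite inE => -[/= hc]; rewrite in_itv /= => /andP[c1 c2] cmin.
have hpos s : a < s < c -> 0 < h s.
  move=> /andP[as_ sc]; have [|se] := ltP s (a + e); first exact: he'.
  rewrite ltNge; apply/negP => hs.
  have /cmin /= : s \in D.
    by rewrite inE; split; rewrite /= ?oppr_ge0 // in_itv /=; lra.
  by rewrite leNgt sc.
exists c; split=> //; first by lra.
apply/eqP; rewrite eq_le; rewrite oppr_ge0 in hc; rewrite hc /= leNgt; apply/negP => hc'.
have n1 : \forall s \near c^'-, h s < 0.
  by apply: near_left; apply: (cvgr_lt _ (ch c)).
have ac : a < c by lra.
have [s [hs [s1 s2]]] := @filter_ex _ (c^'-) _ _ (filterI n1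
  (filterI (nbhs_left_lt c) (nbhs_left_gt ac))).
have /hpos : a < s < c by apply/andP.
by move: hs => /= /lt_trans/[apply]; rewrite ltxx.
Qed.

(* y and w are the graphs of the upper and of the (negated) lower arc.  Reflected
   in x = 0, the left arcs lie strictly outside the right ones, so y^2 - w^2,
   whose derivative is - 2 b x (y + w), decreases faster along them. *)
Lemma arc_comparison (b al al' be : R) (g y w : R -> R) : 0 < b ->
  al <= al' -> al' < 0 -> 0 < be ->
  (forall z, 0 < z -> - g (- z) < g z) ->
  {within `[al, be], continuous y} -> {within `[al', be], continuous w} ->
  y be = 0 -> w be = 0 -> w al' = 0 ->
  (forall z, al < z < be -> 0 < y z) -> (forall z, al' < z < be -> 0 < w z) ->
  (forall z, al < z < be ->
     is_derive z 1 (fun u => y u ^+ 2) (- 2 * (b * z * y z + g z))) ->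
  (forall z, al' < z < be ->
     is_derive z 1 (fun u => w u ^+ 2) (- 2 * (- (b * z) * w z + g z))) -> False.
Proof.
move=> b0 le al0 be0 gP cy cw ybe wbe wal yP wP dy dw.
pose l := Num.min be (- al').
have l0 : 0 < l by rewrite lt_min be0 oppr_gt0.
have lb : l <= be by rewrite ge_min lexx.
have la : l <= - al' by rewrite ge_min lexx orbT.
have dyN z : al < - z < be -> is_derive z 1 (fun u => y (- u) ^+ 2)
    (2 * (- (b * z) * y (- z) + g (- z))).
  move=> /dy dyz; have dN : is_derive z 1 (fun u => - u : R) (-1) by apply: is_derive_eq.
  have := is_derive1_comp dyz dN.
  set r := (X in is_derive _ _ _ X -> _); set r' := (X in _ -> is_derive _ _ _ X).
  by have -> : r = r' by rewrite /r /r'; ring.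
have dwN z : al' < - z < be -> is_derive z 1 (fun u => w (- u) ^+ 2)
    (2 * (b * z * w (- z) + g (- z))).
  move=> /dw dwz; have dN : is_derive z 1 (fun u => - u : R) (-1) by apply: is_derive_eq.
  have := is_derive1_comp dwz dN.
  set r := (X in is_derive _ _ _ X -> _); set r' := (X in _ -> is_derive _ _ _ X).
  by have -> : r = r' by rewrite /r /r'; ring.
have cyR : {within `[0, l], continuous y}.
  by apply: continuous_subspaceW cy; apply: subset_itv; rewrite bnd_simp; lra.
have cwR : {within `[0, l], continuous w}.
  by apply: continuous_subspaceW cw; apply: subset_itv; rewrite bnd_simp; lra.
have cyL : {within `[0, - al'], continuous (fun u => y (- u))}.
  apply: (@within_continuous_compN _ _ _ y); rewrite opprK oppr0.
  by apply: continuous_subspaceW cy; apply: subset_itv; rewrite bnd_simp; lra.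
have cwL : {within `[0, - al'], continuous (fun u => w (- u))}.
  apply: (@within_continuous_compN _ _ _ w); rewrite opprK oppr0.
  by apply: continuous_subspaceW cw; apply: subset_itv; rewrite bnd_simp; lra.
have sub : `[0, l] `<=` `[0, - al'] by apply: subset_itv; rewrite bnd_simp; lra.
have cyl := continuous_subspaceW sub cyL; have cwl := continuous_subspaceW sub cwL.
have sq A (h : R -> R) : {within A, continuous h} -> {within A, continuous (fun u => h u ^+ 2)}.
  move=> ch u; rewrite (_ : (fun u => h u ^+ 2) = (fun u => h u * h u)) //.
  by apply: cvgM; exact: ch.
pose U z := y (- z) ^+ 2 - y z ^+ 2.
pose V z := w (- z) ^+ 2 - w z ^+ 2.
have cU : {within `[0, l], continuous U} by move=> u; apply: cvgB; exact: sq.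
have cV : {within `[0, l], continuous V} by move=> u; apply: cvgB; exact: sq.
have U0 : U 0 = 0 by rewrite /U oppr0 subrr.
have V0 : V 0 = 0 by rewrite /V oppr0 subrr.
pose dl z := g z + g (- z).
have dlP z : 0 < z -> 0 < dl z by move=> /gP; rewrite /dl; lra.
have dU z : 0 < z < l -> is_derive z 1 U (2 * dl z - 2 * b * z * (y (- z) - y z)).
  move=> /andP[z0 zl]; have i1 : al < - z < be by lra.
  have i2 : al < z < be by lra.
  have d1 := dyN _ i1; have d2 := dy _ i2.
  by apply: (is_derive_eq (is_deriveB d1 d2)); rewrite /dl; ring.
have dV z : 0 < z < l -> is_derive z 1 V (2 * dl z + 2 * b * z * (w (- z) - w z)).
  move=> /andP[z0 zl]; have i1 : al' < - z < be by lra.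
  have i2 : al' < z < be by lra.
  have d1 := dwN _ i1; have d2 := dw _ i2.
  by apply: (is_derive_eq (is_deriveB d1 d2)); rewrite /dl; ring.
have lt_sq (p q : R) : 0 < p -> 0 < q -> (0 < q ^+ 2 - p ^+ 2) = (p < q).
  by move=> p0 q0; rewrite subr_gt0 ltr_pXn2r // nnegrE ltW.
have yLR z : 0 < z < l -> y z < y (- z).
  move=> /andP[z0 zl]; rewrite -lt_sq; try by apply: yP; lra.
  apply: (@pos_of_pos_derive U (fun z => 2 * dl z - 2 * b * z * (y (- z) - y z)) 0 z) => //.
  - by apply: continuous_subspaceW cU; apply: subset_itv; rewrite bnd_simp // ltW.
  - by move=> s /andP[s0 sz]; apply: dU; lra.
  move=> s /andP[s0 sz] Us; rewrite mul0r.
  have ys : y (- s) <= y s.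
    by rewrite leNgt -lt_sq ?leNgt; try (by apply: yP; lra); rewrite -leNgt.
  have h1 := dlP _ s0.
  have : 0 <= 2 * b * s * (y s - y (- s)).
    by rewrite !mulr_ge0 ?subr_ge0 // ltW.
  lra.
(* On the lower arc the damping term has the wrong sign where V <= 0. It is a multiple of V divided
   by w z + w (- z), so the minimum of [w] on [0, z] gives a rate for the integrating factor. *)
have wLR z : 0 < z < l -> w z < w (- z).
  move=> /andP[z0 zl]; rewrite -lt_sq; try by apply: wP; lra.
  have cwz : {within `[0, z], continuous w}.
    by apply: continuous_subspaceW cwR; apply: subset_itv; rewrite bnd_simp // ltW.
  have [m] := EVT_min (ltW z0) cwz; rewrite in_itv /= => /andP[m0 mz] mmin.
  have wm : 0 < w m by apply: wP; lra.
  apply: (@pos_of_pos_derive V (fun z => 2 * dl z + 2 * b * z * (w (- z) - w z))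
    (2 * b * z / w m) z) => //.
  - by apply: continuous_subspaceW cV; apply: subset_itv; rewrite bnd_simp // ltW.
  - by move=> s /andP[s0 sz]; apply: dV; lra.
  move=> s /andP[s0 sz] Vs.
  have ws : w (- s) <= w s.
    by rewrite leNgt -lt_sq ?leNgt; try (by apply: wP; lra); rewrite -leNgt.
  have h1 := dlP _ s0.
  have wms : w m <= w s by apply: mmin; rewrite in_itv /= sz ltW.
  have wN : 0 < w (- s) by apply: wP; lra.
  have -> : 2 * b * z / w m * V s = - (2 * b * (w s - w (- s))) * (z * ((w s + w (- s)) / w m)).
    by rewrite /V; field; rewrite gt_eqF.
  have h2 : s <= z * ((w s + w (- s)) / w m).
    apply: le_trans sz _; rewrite ler_pMr // ler_pdivlMr // mul1r; lra.
  have h3 : 0 <= 2 * b * (w s - w (- s)) * (z * ((w s + w (- s)) / w m) - s).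
    by rewrite !mulr_ge0 ?subr_ge0 // ltW.
  lra.
have Nl : 0 < V l - U l.
  have cN : {within `[0, l], continuous (fun z => V z - U z)}.
    by move=> u; apply: cvgB; [exact: cV | exact: cU].
  have : V 0 - U 0 < V l - U l.
    apply: (is_derive_gt0_lt l0 _ cN).
      by move=> s sl; apply: (is_deriveB (dV s sl) (dU s sl)).
    move=> s sl /=; have := yLR s sl; have := wLR s sl; case/andP: sl => s0 _.
    move=> h1 h2; have : 0 < 2 * b * s * ((w (- s) - w s) + (y (- s) - y s)).
      by rewrite !mulr_gt0 //; lra.
    lra.
  by rewrite V0 U0 subrr.
(* If the right arcs end first, both vanish at [be], so w^2 > y^2 at - be. This persists leftwards
   down to al', where w = 0. Otherwise w vanishes at - l, making V l <= 0 although V increases from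
   0. *)
have [bl|bl] := leP be (- al').
  have lE : l = be by rewrite /l (min_idPl bl).
  have : y (- be) ^+ 2 - w (- be) ^+ 2 < 0.
    by move: Nl; rewrite /V /U lE ybe wbe expr0n /=; lra.
  have cP : {within `[be, - al'], continuous (fun z => w (- z) ^+ 2 - y (- z) ^+ 2)}.
    have subP : `[be, - al'] `<=` `[0, - al'] by apply: subset_itv; rewrite bnd_simp; lra.
    by move=> u; apply: cvgB; apply: sq; exact: (continuous_subspaceW subP).
  have : w (- be) ^+ 2 - y (- be) ^+ 2 <= w (- - al') ^+ 2 - y (- - al') ^+ 2.
    apply: (is_derive_ge0_le bl _ cP).
      move=> s /andP[s1 s2]; apply: is_deriveB; [apply: dwN; lra | apply: dyN; lra].
    move=> s /andP[s1 s2] /=.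
    have h1 : 0 < w (- s) by apply: wP; lra.
    have h2 : 0 < y (- s) by apply: yP; lra.
    have : 0 <= b * s * (w (- s) + y (- s)).
      by rewrite mulr_ge0 ?addr_ge0 ?mulr_ge0 // ?ltW // (lt_trans be0).
    lra.
  by rewrite opprK wal expr0n /=; have := sqr_ge0 (y al'); lra.
have lE : l = - al' by rewrite /l (min_idPr (ltW bl)).
have : V 0 < V l.
  apply: (is_derive_gt0_lt l0 dV cV) => s sl; have := wLR s sl; case/andP: sl => s0 _.
  move=> h1; have := dlP _ s0.
  have : 0 < 2 * b * s * (w (- s) - w s) by rewrite !mulr_gt0 //; lra.
  lra.
by rewrite V0 /V lE opprK wal expr0n /=; have := sqr_ge0 (w (- al')); lra.
Qed.

(* Starting from the leftmost point of the orbit, the next lower arc cannot end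
   further left; no uniqueness of solutions is needed to close the loop. *)
Lemma all_closed_symmetry (g : R -> R) (b : R) :
  all_closed g (fun u => b * u) -> continuous g -> 0 < b ->
  (forall u, 0 < u -> 0 < g u) -> (forall u, u < 0 -> g u < 0) ->
  ~ (forall u, 0 < u -> - g (- u) < g u).
Proof.
move=> A cg b0 gpos gneg gP.
have gle0 u : u != 0 -> g u <= 0 -> u < 0.
  move=> u0 gu; rewrite lt_neqAle u0 leNgt; apply/negP => /gpos.
  by rewrite ltNge gu.
have [|x [y [T [orb _ _ nz _]]]] := A 1 0; first by rewrite oner_eq0.
have dx := orbit_dx orb; have dy := orbit_dy orb.
have cx := orbit_cx orb; have cy := orbit_cy orb.
have cNy : continuous (fun t => - y t) by move=> t; apply: cvgN; exact: cy.
have [T0 px py _ _] := orb.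
have dNx t : is_derive t 1 (fun t => - x t) (- y t).
  by have dxt := dx t; apply: is_derive_eq.
have dNy t : is_derive t 1 (fun t => - y t) (- (- g (x t) - b * x t * y t)).
  by have dyt := dy t; apply: is_derive_eq.
have [|||t1 _ t1max] := @orbit_max _ _ _ _ _ orb (fun u _ => - u) setT _ (@closedT _).
- by move=> t; exact: is_derive_continuous (dNx t).
- by [].
- by exists 0.
have xmin t : x t1 <= x t by rewrite -lerN2; exact: t1max.
have yt1 : y t1 = 0.
  apply/eqP; rewrite -oppr_eq0; apply/eqP.
  apply: (max_is_derive0 (dNx t1)); apply: filterE => t; exact: t1max.
have xt1 : x t1 != 0 by have := nz t1; rewrite yt1 eqxx orbF.
(* At a leftmost point with x > 0, g > 0 would make y negative just after and push the orbit further
   left. *)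
have x1 : x t1 < 0.
  rewrite lt_neqAle xt1 leNgt; apply/negP => x1.
  have p : 0 < - (- g (x t1) - b * x t1 * y t1).
    by rewrite yt1 mulr0 subr0 opprK gpos.
  have := gt0_is_derive_right (dNy t1) p; rewrite yt1 oppr0 => yr.
  have [t] := @filter_ex _ (t1^'+) _ _ (is_derive_right_lt dNx yr).
  by rewrite ltrN2 ltNge xmin.
have y1 : \forall s \near t1^'+, 0 < y s.
  have p : 0 < - g (x t1) - b * x t1 * y t1.
    by rewrite yt1 mulr0 subr0 oppr_gt0 gneg.
  by have := gt0_is_derive_right (dy t1) p; rewrite yt1.
have [||t2 [t12 yt2 y12]] := @first_zero y t1 (t1 + T) cy _ y1.
- by rewrite ltrDl.
- by rewrite py yt1.
have xt2 : x t2 != 0 by have := nz t2; rewrite yt2 eqxx orbF.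
have x2 : 0 < x t2.
  rewrite lt_neqAle eq_sym xt2 leNgt; apply/negP => /gneg g2.
  have p : 0 < - g (x t2) - b * x t2 * y t2.
    by rewrite yt2 mulr0 subr0 oppr_gt0.
  have nl := near_left (gt0_is_derive_near (dy t2) p).
  have [s [[_ s1] [s2 s3]]] := @filter_ex _ (t2^'-) _ _ (filterI nl
    (filterI (nbhs_left_lt t2) (nbhs_left_gt t12))).
  have := s1 s2; rewrite yt2 ltNge => /negP; apply.
  by apply/ltW/y12/andP.
have y2 : \forall s \near t2^'+, 0 < - y s.
  have p : 0 < - (- g (x t2) - b * x t2 * y t2).
    by rewrite yt2 mulr0 subr0 opprK gpos.
  by have := gt0_is_derive_right (dNy t2) p; rewrite yt2 oppr0.
have [||t3 [t23 yt3 y23]] := @first_zero (fun t => - y t) t2 (t2 + T) cNy _ y2.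
- by rewrite ltrDl.
- by rewrite py yt2 oppr0.
have {}yt3 : y t3 = 0 by apply/eqP; rewrite -oppr_eq0 yt3.
have xt3 : x t3 != 0 by have := nz t3; rewrite yt3 eqxx orbF.
have x3 : x t3 < 0.
  rewrite lt_neqAle xt3 leNgt; apply/negP => /gpos g3.
  have p : 0 < - (- g (x t3) - b * x t3 * y t3).
    by rewrite yt3 mulr0 subr0 opprK.
  have nl := near_left (gt0_is_derive_near (dNy t3) p).
  have [s [[_ s1] [s2 s3]]] := @filter_ex _ (t3^'-) _ _ (filterI nl
    (filterI (nbhs_left_lt t3) (nbhs_left_gt t23))).
  have := s1 s2; rewrite yt3 oppr0 ltNge => /negP; apply.
  by apply/ltW/y23/andP.
have [x12 [h [h1 h2 ch hpos dh]]] := lienard_arc t12 dx dy y12.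
(* Reversal turns the lower arc into an upper one with damping - b x, so the same graph lemma
   applies. *)
have rev := orbit_reverse orb.
have t23' : - t3 < - t2 by rewrite ltrN2.
have [|x32 [w]] := lienard_arc t23' (orbit_dx rev) (orbit_dy rev).
  by move=> t /andP[s2 s3]; apply: y23; rewrite ltrNr s3 ltrNl.
rewrite !opprK => -[w1 w2 cw wpos dw].
apply: (@arc_comparison b (x t1) (x t3) (x t2) g h w) => //.
- by rewrite h2.
- by rewrite w2 yt2 oppr0.
- by rewrite w1 yt3 oppr0.
Qed.

(** Here g (x) + g (- x) = 2 a4 x^4. Reversal changes the sign of b alone and reflection those of
    both b and a4, so b > 0 and a4 > 0 is the only case. *)
Lemma all_closed_even_part (a1 a3 a4 a5 b : R) : b != 0 ->
  all_closed (quintic a1 0 a3 a4 a5) (fun u => b * u) -> a4 = 0.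
Proof.
have core p q r s t : 0 < t -> all_closed (quintic p 0 q r s) (fun u => t * u) -> ~ 0 < r.
  move=> t0 A r0; have [|h1 h2] := all_closed_quintic_sign A.
    by move=> u; apply: is_derive_continuous; apply: is_derive_eq.
  apply: (all_closed_symmetry A (@continuous_quintic _ _ _ _ _) t0 h1 h2) => u u0.
  rewrite /quintic; have : 0 < r * u ^+ 4 by rewrite mulr_gt0 // exprn_gt0.
  lra.
have rev p q r s t : all_closed (quintic p 0 q r s) (fun u => t * u) ->
    all_closed (quintic p 0 q r s) (fun u => - t * u).
  move=> /all_closed_reverse; congr (all_closed _ _).
  by apply/funext => u; rewrite mulNr.
have mir p q r s t : all_closed (quintic p 0 q r s) (fun u => t * u) ->
    all_closed (quintic p 0 q (- r) s) (fun u => - t * u).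
  move=> /all_closed_mirror; congr (all_closed _ _); apply/funext => u.
    by rewrite /quintic; ring.
  by rewrite mulrN mulNr.
move=> b0 A; have {b0 b A} [b b0 A] : exists2 b, 0 < b &
    all_closed (quintic a1 0 a3 a4 a5) (fun u => b * u).
  have [b0'|b0'] := ltP 0 b; first by exists b.
  by exists (- b); [rewrite oppr_gt0 lt_neqAle b0 | exact: rev].
have [r0|r0|//] := ltgtP a4 0.
  have A' := rev _ _ _ _ _ (mir _ _ _ _ _ A); rewrite opprK in A'.
  by case: (core _ _ _ _ _ b0 A'); rewrite oppr_gt0.
by case: (core _ _ _ _ _ b0 A).
Qed.

(** * Coefficients forced to vanish or to be positive *)

Definition quartic (b1 b2 b3 b4 u : R) : R :=
  b1 * u + b2 * u ^+ 2 + b3 * u ^+ 3 + b4 * u ^+ 4.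

Lemma monomial_le (a u : R) (i k : nat) : (i <= k)%N -> 1 <= u ->
  a * u ^+ i <= `|a| * u ^+ k.
Proof.
move=> ik u1; apply: (@le_trans _ _ (`|a| * u ^+ i)).
  by apply: ler_wpM2r; [rewrite exprn_ge0 //; lra | exact: ler_norm].
by apply: ler_wpM2l => //; exact: ler_weXn2l.
Qed.

Lemma all_closed_cubic_damping (a1 a2 a3 a4 a5 b1 b2 b3 b4 : R) :
  all_closed (quintic a1 a2 a3 a4 a5) (quartic b1 b2 b3 b4) -> b3 = 0 /\ b4 = 0.
Proof.
have hg u : 1 <= u -> quintic a1 a2 a3 a4 a5 u <=
    (`|a1| + `|a2| + `|a3| + `|a4| + `|a5|) * u ^+ 5.
  by move=> u1; rewrite /quintic -[a1 * u]/(a1 * u ^+ 1) !mulrDl !lerD // monomial_le.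
have core4 p q r s : all_closed (quintic a1 a2 a3 a4 a5) (quartic p q r s) -> ~ s < 0.
  move=> A s0; apply: (all_closed_growth (c := - s) (C' := `|p| + `|q| + `|r|) (k := 3)
    A _ _ _ hg) => //.
    by rewrite oppr_gt0.
  move=> u u1; rewrite /quartic.
  have := @monomial_le p u 1 3 isT u1; have := @monomial_le q u 2 3 isT u1.
  have := @monomial_le r u 3 3 isT u1; rewrite expr1; lra.
have core3 p q r : all_closed (quintic a1 a2 a3 a4 a5) (quartic p q r 0) -> ~ r < 0.
  move=> A s0; apply: (all_closed_growth (c := - r) (C' := `|p| + `|q|) (k := 2) A _ _ _ hg) => //.
    by rewrite oppr_gt0.
  move=> u u1; rewrite /quartic.
  have := @monomial_le p u 1 2 isT u1; have := @monomial_le q u 2 2 isT u1.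
  rewrite expr1; lra.
have rev p q r s : all_closed (quintic a1 a2 a3 a4 a5) (quartic p q r s) ->
    all_closed (quintic a1 a2 a3 a4 a5) (quartic (- p) (- q) (- r) (- s)).
  move=> /all_closed_reverse; congr (all_closed _ _).
  by apply/funext => u; rewrite /quartic; ring.
move=> A; have b40 : b4 = 0.
  have [s0|s0|//] := ltgtP b4 0; first by case: (core4 _ _ _ _ A).
  by case: (core4 _ _ _ _ (rev _ _ _ _ A)); rewrite oppr_lt0.
split=> //; rewrite b40 in A.
have [s0|s0|//] := ltgtP b3 0; first by case: (core3 _ _ _ A).
have := rev _ _ _ _ A; rewrite oppr0 => A'.
by case: (core3 _ _ _ A'); rewrite oppr_lt0.
Qed.

Lemma all_closed_lead_gt0 (a1 a2 a3 a4 a5 : R) (f : R -> R) :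
  all_closed (quintic a1 a2 a3 a4 a5) f -> continuous f -> a5 != 0 -> 0 < a5.
Proof.
move=> A cf a50; have [gpos _] := all_closed_quintic_sign A cf.
rewrite lt_neqAle eq_sym a50 leNgt; apply/negP => a5n.
have [||X X0 hX] := @near_infinity_gt0 (fun z =>
    - (a1 * z ^+ 4 + a2 * z ^+ 3 + a3 * z ^+ 2 + a4 * z + a5)).
- by apply: is_derive_continuous; apply: is_derive_eq.
- by rewrite !expr0n /= !mulr0 !add0r oppr_gt0.
have u0 : 0 < X + 1 by lra.
have := gpos _ u0; have -> : quintic a1 a2 a3 a4 a5 (X + 1) =
  - ((X + 1) ^+ 5 * - (a1 * (X + 1)^-1 ^+ 4 + a2 * (X + 1)^-1 ^+ 3
    + a3 * (X + 1)^-1 ^+ 2 + a4 * (X + 1)^-1 + a5)).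
  by rewrite /quintic; field; rewrite gt_eqF.
rewrite oppr_gt0 ltNge => /negP; apply; apply: mulr_ge0; first by rewrite exprn_ge0 // ltW.
by apply/ltW/hX; rewrite gtr0_norm //; lra.
Qed.

Lemma near_zero_gt0 (k : R -> R) : {for 0, continuous k} -> 0 < k 0 ->
  exists2 e, 0 < e & 0 < k e /\ 0 < k (- e).
Proof.
move=> ck k0; have : \forall z \near 0, 0 < k z by apply: (cvgr_gt _ ck).
move=> [e /= e0 he]; exists (e / 2); first by rewrite divr_gt0.
by split; apply: he; rewrite /ball_ /= sub0r normrN ?normrN gtr0_norm; lra.
Qed.

(** The lowest term of g must change sign with x. Strictness of a3 > 0 comes later, from c^2 < 8
    a3. *)
Lemma all_closed_nilpotent_coef (a2 a3 a4 a5 : R) (f : R -> R) :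
  all_closed (quintic 0 a2 a3 a4 a5) f -> continuous f -> a2 = 0 /\ 0 <= a3.
Proof.
move=> A cf; have [gpos gneg] := all_closed_quintic_sign A cf.
pose k2 (z : R) := a2 + a3 * z + a4 * z ^+ 2 + a5 * z ^+ 3.
pose k3 (z : R) := a3 + a4 * z + a5 * z ^+ 2.
have ck2 : {for 0, continuous k2}.
  by apply: is_derive_continuous; rewrite /k2; apply: is_derive_eq.
have cNk2 : {for 0, continuous (fun z => - k2 z)} by apply: cvgN; exact: ck2.
have cNk3 : {for 0, continuous (fun z => - k3 z)}.
  by apply: is_derive_continuous; rewrite /k3; apply: is_derive_eq.
have k20 : k2 0 = a2 by rewrite /k2 !expr0n /= !mulr0 !addr0.
have k30 : k3 0 = a3 by rewrite /k3 !expr0n /= !mulr0 !addr0.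
have gE u : quintic 0 a2 a3 a4 a5 u = u ^+ 2 * k2 u by rewrite /quintic /k2; ring.
have sq (e : R) : 0 < e -> 0 < e ^+ 2 by move=> e0; rewrite exprn_gt0.
have a20 : a2 = 0.
  have [a2n|a2p|//] := ltgtP a2 0.
    have [||e e0 [h _]] := @near_zero_gt0 (fun z => - k2 z) => //.
      by rewrite k20 oppr_gt0.
    have := gpos _ e0; rewrite gE pmulr_rgt0 ?sq //; lra.
  have [||e e0 [_ h]] := @near_zero_gt0 k2 => //; first by rewrite k20.
  have e0' : - e < 0 by rewrite oppr_lt0.
  by have := gneg _ e0'; rewrite gE sqrrN pmulr_rlt0 ?sq //; lra.
split=> //; rewrite leNgt; apply/negP => a3n.
have [||e e0 [h _]] := @near_zero_gt0 (fun z => - k3 z) => //.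
  by rewrite k30 oppr_gt0.
have := gpos _ e0; have -> : quintic 0 a2 a3 a4 a5 e = e ^+ 3 * k3 e.
  by rewrite /quintic /k3 a20; ring.
by rewrite pmulr_rgt0 ?exprn_gt0 //; lra.
Qed.

Lemma all_closed_damping (a1 a2 a3 a4 a5 b1 b2 b3 b4 : R) :
  all_closed (quintic a1 a2 a3 a4 a5) (quartic b1 b2 b3 b4) ->
  [/\ b3 = 0, b4 = 0 & a5 != 0 -> 0 < a5 /\ b2 = 0].
Proof.
move=> A; have [b30 b40] := all_closed_cubic_damping A.
split=> // a5n.
have cq p q r s : continuous (quartic p q r s).
  by move=> u; apply: is_derive_continuous; rewrite /quartic; apply: is_derive_eq.
have a50 := all_closed_lead_gt0 A (cq _ _ _ _) a5n.
have E p q : quartic p q 0 0 = (fun u => p * u + q * u ^+ 2).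
  by apply/funext => u; rewrite /quartic !mul0r !addr0.
split=> //; rewrite b30 b40 E in A.
have [b2n|b2p|//] := ltgtP b2 0; last by case: (all_closed_quadratic_damping A a50).
have := all_closed_reverse A => A'.
have {}A' : all_closed (quintic a1 a2 a3 a4 a5) (fun u => - b1 * u + - b2 * u ^+ 2).
  by move: A'; congr (all_closed _ _); apply/funext => u; ring.
by case: (all_closed_quadratic_damping A' a50); rewrite oppr_gt0.
Qed.

(** * Rescaling to the normal forms *)

Lemma rescale_linear (a1 a3 a5 b : R) : 0 < a1 -> 0 < a5 -> b != 0 ->
  (forall u, 0 < u -> 0 < quintic a1 0 a3 0 a5 u) ->
  exists A B : R, [/\ -2 < A, B != 0 &
    rescales_to (fun p => (p.2, - quintic a1 0 a3 0 a5 p.1 - b * p.1 * p.2))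
      (fun p => (p.2, - (p.1 + A * p.1 ^+ 3 + p.1 ^+ 5) - B * p.1 * p.2))].
Proof.
move=> a10 a50 b0 gpos.
(* [ga] normalizes the linear term, and q^4 = a5 / a1 makes the quintic coefficient equal to it. The
   point 1 / q becomes 1, where positivity of g reads 2 + A > 0. *)
pose ga := Num.sqrt a1; pose q := Num.sqrt (Num.sqrt (a5 / a1)).
have ga0 : 0 < ga by rewrite sqrtr_gt0.
have q0 : 0 < q by rewrite !sqrtr_gt0 divr_gt0.
have a1E : a1 = ga ^+ 2 by rewrite sqr_sqrtr // ltW.
have a5E : a5 = ga ^+ 2 * q ^+ 4.
  rewrite -a1E (exprM q 2 2) !sqr_sqrtr ?sqrtr_ge0 ?divr_ge0 // ?ltW //.
  by rewrite mulrC divfK // gt_eqF.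
have gan : ga != 0 by rewrite gt_eqF.
have qn : q != 0 by rewrite gt_eqF.
exists (a3 / (ga ^+ 2 * q ^+ 2)), (b / (ga * q)); split.
- have := gpos q^-1; rewrite invr_gt0 => /(_ q0).
  have -> : quintic a1 0 a3 0 a5 q^-1 = ga ^+ 2 / q * (2 + a3 / (ga ^+ 2 * q ^+ 2)).
    by rewrite /quintic a1E a5E; field; rewrite gan qn.
  by rewrite pmulr_rgt0 ?divr_gt0 ?exprn_gt0 //; lra.
- by rewrite !mulf_neq0 // invr_eq0 mulf_neq0.
exists q, (q / ga), ga; split=> //; first by rewrite mulf_neq0 // invr_eq0.
move=> [u v]; rewrite /rescale /quintic /= a1E a5E.
by congr pair; field; rewrite gan qn.
Qed.

Lemma rescale_nilpotent (a3 a5 b : R) : 0 < a3 -> 0 < a5 -> b != 0 ->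
  b ^+ 2 < 8 * a3 ->
  exists2 C : R,
    (- (2 * Num.sqrt 2) < C < 0) \/ (0 < C < 2 * Num.sqrt 2) &
    rescales_to (fun p => (p.2, - quintic 0 0 a3 0 a5 p.1 - b * p.1 * p.2))
      (fun p => (p.2, - (p.1 ^+ 3 + p.1 ^+ 5) - C * p.1 * p.2)).
Proof.
move=> a30 a50 b0 lt.
(* q^2 = a5 / a3 balances the cubic and quintic terms, and C = b / s turns b^2 < 8 a3 into C^2 <
   8. *)
pose s := Num.sqrt a3; pose q := Num.sqrt (a5 / a3).
have s0 : 0 < s by rewrite sqrtr_gt0.
have q0 : 0 < q by rewrite sqrtr_gt0 divr_gt0.
have a3E : a3 = s ^+ 2 by rewrite sqr_sqrtr // ltW.
have a5E : a5 = s ^+ 2 * q ^+ 2.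
  rewrite -a3E sqr_sqrtr ?divr_ge0 ?ltW //.
  by rewrite mulrC divfK // gt_eqF.
have sn : s != 0 by rewrite gt_eqF.
have qn : q != 0 by rewrite gt_eqF.
exists (b / s); last first.
  exists q, (q ^+ 2 / s), (s / q); split=> //.
  - by rewrite mulf_neq0 ?expf_neq0 // invr_eq0.
  - by rewrite mulf_neq0 ?invr_eq0.
  move=> [u v]; rewrite /rescale /quintic /= a3E a5E.
  by congr pair; field; rewrite sn qn.
have C8 : (b / s) ^+ 2 < 8.
  by rewrite expr_div_n -a3E ltr_pdivrMr.
have Cn : b / s != 0 by rewrite mulf_neq0 // invr_eq0.
have r0 : 0 <= Num.sqrt (2 : R) by exact: sqrtr_ge0.
have r2 : Num.sqrt (2 : R) ^+ 2 = 2 by rewrite sqr_sqrtr.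
have : `|b / s| < 2 * Num.sqrt 2.
  rewrite -(ltr_pXn2r (n := 2)) // ?nnegrE // ?mulr_ge0 //.
  have e8 : (2 * Num.sqrt (2 : R)) ^+ 2 = 8 by rewrite exprMn r2; ring.
  by rewrite real_normK ?num_real // e8.
rewrite ltr_norml => /andP[c1 c2]; move: Cn; rewrite neq_lt => /orP[c|c]; [left|right].
  by rewrite c1.
by rewrite c.
Qed.

(** * Jacobian matrix and eigenvalues at the origin *)

Lemma is_derive_line (F : R * R -> R) (v p : R * R) (d : R) :
  is_derive (0 : R) 1 (fun h : R => F (h *: v + p)) d -> 'D_v F p = d.
Proof.
move=> [_ <-].
suff E : (fun h : R => h^-1 *: ((F \o shift p) (h *: v) - F p)) =
    (fun h : R => h^-1 *: (((fun h0 : R => F (h0 *: v + p)) \o shift 0) (h *: 1)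
      - F (0 *: v + p))) by rewrite /derive E.
apply/funext => h /=; by rewrite addr0 scale0r add0r /GRing.scale /= mulr1.
Qed.

Lemma jacobian2_lienard (g f : {poly R}) :
  let J := jacobian2 (lienard g f) (0, 0) in
  [/\ J 0 0 = 0, J 0 1 = 1, J 1 0 = - g^`().[0] & J 1 1 = - f.[0]].
Proof.
move=> J; rewrite /J /jacobian2 /lienard; split; rewrite mxE /=.
- apply: is_derive_line => /=.
  rewrite [X in is_derive _ _ X](_ : _ = cst 0); first by apply: is_derive_cst.
  by apply/funext => h /=; rewrite addr0 scaler0.
- apply: is_derive_line => /=.
  rewrite [X in is_derive _ _ X](_ : _ = id); first by apply: is_derive_id.
  by apply/funext => h /=; rewrite addr0 [_%:A]mulr1.
- apply: is_derive_line => /=.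
  rewrite [X in is_derive _ _ X](_ : _ = - (horner g)); first by apply: is_derive_eq.
  apply/funext => h /=; rewrite [_%:A]mulr1 !addr0 scaler0 mulr0 subr0.
  by [].
apply: is_derive_line => /=.
rewrite [X in is_derive _ _ X](_ : _ = (fun h : R => - g.[0] - f.[0] * h)); first last.
  by apply/funext => h /=; rewrite scaler0 !addr0 [_%:A]mulr1.
by apply: is_derive_eq; rewrite /GRing.scale /=; ring.
Qed.

Lemma complex_eigenvalue_root (J : 'M[R]_2) (g1 f0 : R) (l : complex.complex R) :
  J 0 0 = 0 -> J 0 1 = 1 -> J 1 0 = - g1 -> J 1 1 = - f0 ->
  l ^+ 2 + complex.Complex f0 0 * l + complex.Complex g1 0 = 0 ->
  complex_eigenvalue J l.
Proof.
move=> j00 j01 j10 j11 e; apply/eigenvalueP.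
(* Eigenvectors are rows acting on the left: (l + f0, 1) is one for every root l of l^2 + f0 l +
   g1. *)
exists (\row_(j < 2) if j == 0 then l + complex.Complex f0 0 else 1); last first.
  by apply/eqP => /rowP /(_ 1); rewrite !mxE /= => /eqP; rewrite oner_eq0.
have j00' : J ord0 ord0 = 0 := j00.
have j01' : J ord0 (lift ord0 ord0) = 1 by rewrite -j01; congr (J _ _); apply/val_inj.
have j10' : J (lift ord0 ord0) ord0 = - g1 by rewrite -j10; congr (J _ _); apply/val_inj.
have j11' : J (lift ord0 ord0) (lift ord0 ord0) = - f0.
  by rewrite -j11; congr (J _ _); apply/val_inj.
have mN (z : R) : complex.real_complex R (- z) = - complex.Complex z 0.
  by apply/eqP; rewrite complex.eq_complex /= oppr0 !eqxx.
apply/rowP => j; rewrite !mxE big_ord_recl big_ord1 !mxE /=.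
have [->|->] : j = ord0 \/ j = lift ord0 ord0.
  by case: j => -[|[|//]] ?; [left|right]; apply/val_inj.
  rewrite j00' j10' mN /= mul1r.
  rewrite (_ : complex.real_complex R 0 = 0) // mulr0 add0r.
  by move/eqP: e; rewrite addr_eq0 => /eqP <-; rewrite expr2; ring.
rewrite j01' j11' mN /= mulr1 mul1r.
by rewrite mulr1 addrK.
Qed.

Lemma real_root (g1 f0 z : R) : z ^+ 2 + f0 * z + g1 = 0 ->
  complex.Complex z 0 ^+ 2 + complex.Complex f0 0 * complex.Complex z 0
    + complex.Complex g1 0 = 0.
Proof.
move=> e; apply/eqP; rewrite expr2 complex.eq_complex /=.
by apply/andP; split; apply/eqP; [rewrite -[RHS]e /=|]; ring.
Qed.

Lemma imaginary_root (g1 f0 : R) : f0 ^+ 2 - 4 * g1 < 0 ->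
  let l := complex.Complex (- f0 / 2) (Num.sqrt (4 * g1 - f0 ^+ 2) / 2) in
  l ^+ 2 + complex.Complex f0 0 * l + complex.Complex g1 0 = 0.
Proof.
move=> D0 l; have s2 : Num.sqrt (4 * g1 - f0 ^+ 2) ^+ 2 = 4 * g1 - f0 ^+ 2.
  by rewrite sqr_sqrtr //; lra.
apply/eqP; rewrite expr2 complex.eq_complex /l /=.
set s := Num.sqrt _ in s2 *.
apply/andP; split; apply/eqP; last by field.
have -> : g1 = (s ^+ 2 + f0 ^+ 2) / 4 by rewrite s2; field.
by field.
Qed.

Lemma discriminant_root (f0 g1 : R) (e : R) : e ^+ 2 = 1 -> 0 <= f0 ^+ 2 - 4 * g1 ->
  let z := (- f0 + e * Num.sqrt (f0 ^+ 2 - 4 * g1)) / 2 in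
  z ^+ 2 + f0 * z + g1 = 0.
Proof.
move=> e2 D0 z; have s2 := sqr_sqrtr D0; rewrite /z.
set s := Num.sqrt _ in s2 *.
have -> : g1 = (f0 ^+ 2 - e ^+ 2 * s ^+ 2) / 4 by rewrite e2 s2; field.
by field.
Qed.

(** A nonnegative discriminant would give a real eigenvalue, which cannot be both nonzero and of
    real part 0. Otherwise the real part is - f0 / 2. *)
Lemma linear_type_lienard (g f : {poly R}) :
  linear_type (lienard g f) (0, 0) -> f.[0] = 0 /\ 0 < g^`().[0].
Proof.
have [j00 j01 j10 j11] := jacobian2_lienard g f.
set f0 := f.[0] in j11 *; set g1 := g^`().[0] in j10 *.
move=> L; have [D0|D0] := leP 0 (f0 ^+ 2 - 4 * g1).
  have e1 : (1 : R) ^+ 2 = 1 by rewrite expr1n.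
  have [] := L _ (complex_eigenvalue_root j00 j01 j10 j11 (real_root (discriminant_root e1 D0))).
  by move=> /= -> ; rewrite complex.eq_complex /= eqxx.
have [/= re _] := L _ (complex_eigenvalue_root j00 j01 j10 j11 (imaginary_root D0)).
have f00 : f0 = 0 by lra.
by split=> //; move: D0; rewrite f00 expr0n /=; lra.
Qed.

(** Both real roots are 0, so their sum and difference vanish; a negative discriminant would give a
    nonzero imaginary part. *)
Lemma nilpotent_type_lienard (g f : {poly R}) :
  nilpotent_type (lienard g f) (0, 0) -> f.[0] = 0 /\ g^`().[0] = 0.
Proof.
have [j00 j01 j10 j11] := jacobian2_lienard g f.
set f0 := f.[0] in j11 *; set g1 := g^`().[0] in j10 *.
move=> [L _]; have [D0|D0] := leP 0 (f0 ^+ 2 - 4 * g1).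
  have e1 : (1 : R) ^+ 2 = 1 by rewrite expr1n.
  have e2 : (-1 : R) ^+ 2 = 1 by rewrite sqrrN expr1n.
  have [r1] := L _ (complex_eigenvalue_root j00 j01 j10 j11 (real_root (discriminant_root e1 D0))).
  have [r2] := L _ (complex_eigenvalue_root j00 j01 j10 j11 (real_root (discriminant_root e2 D0))).
  have s2 := sqr_sqrtr D0; set s := Num.sqrt _ in s2 r1 r2.
  have f00 : f0 = 0 by lra.
  have s0 : s = 0 by lra.
  by split=> //; move: s2; rewrite s0 f00 !expr0n /=; lra.
have [_ im] := L _ (complex_eigenvalue_root j00 j01 j10 j11 (imaginary_root D0)).
have : 0 < Num.sqrt (4 * g1 - f0 ^+ 2) by rewrite sqrtr_gt0; lra.
by lra.
Qed.

(** * From the polynomial system and its center to [all_closed] *)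

Definition range_coef (a : nat -> R) (r m i : nat) : R :=
  if (r <= i <= m)%N then a i else 0.

Lemma horner_poly_between (a : nat -> R) (r m : nat) (u : R) : (m <= 5)%N ->
  let c := range_coef a r m in
  (poly_between a r m).[u] = c 0%N + quintic (c 1%N) (c 2%N) (c 3%N) (c 4%N) (c 5%N) u.
Proof.
move=> m5 c; rewrite /poly_between horner_sum.
transitivity (\sum_(0 <= i < 6) c i * u ^+ i); last first.
  by rewrite !big_nat_recl // big_geq // /quintic; ring.
rewrite (big_nat_widen _ _ 6) // (big_nat_widenl _ 0) // big_mkcond /=.
apply: eq_bigr => i _; rewrite /c /range_coef ltnS andbC.
by case: ifP => _; rewrite ?mul0r // hornerZ hornerXn.
Qed.

Lemma deriv_poly_between0 (a : nat -> R) (r m : nat) : (m <= 5)%N ->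
  (poly_between a r m)^`().[0] = range_coef a r m 1.
Proof.
move=> m5; have := is_derive_poly (poly_between a r m) 0.
have -> : horner (poly_between a r m) = fun u => range_coef a r m 0%N +
    quintic (range_coef a r m 1) (range_coef a r m 2) (range_coef a r m 3)
      (range_coef a r m 4) (range_coef a r m 5) u.
  by apply/funext => u; rewrite horner_poly_between.
move=> /@derive_val <-; rewrite /quintic; apply: derive_val.
by apply: is_derive_eq; rewrite /GRing.scale /=; ring.
Qed.

Lemma is_derive_pair (phi : R -> R * R) (t : R) (v : R * R) :
  is_derive t 1 phi v ->
  is_derive t 1 (fun s => (phi s).1) v.1 /\ is_derive t 1 (fun s => (phi s).2) v.2.
Proof.
move=> [/cvg_ex[l hl] <-].
have -> : 'D_1 phi t = l by apply/cvg_lim.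
have h1 : h^-1 *: ((phi (h *: 1 + t)).1 - (phi t).1) @[h --> 0^'] --> l.1.
  exact: (cvg_comp _ _ hl (@cvg_fst _ _ _ _ _)).
have h2 : h^-1 *: ((phi (h *: 1 + t)).2 - (phi t).2) @[h --> 0^'] --> l.2.
  exact: (cvg_comp _ _ hl (@cvg_snd _ _ _ _ _)).
split; apply: DeriveDef.
- by apply/cvg_ex; exists l.1.
- exact/cvg_lim.
- by apply/cvg_ex; exists l.2.
- exact/cvg_lim.
Qed.

Lemma is_derive_translate (x : R -> R) (c t d : R) :
  is_derive (t + c) 1 x d -> is_derive t 1 (fun s => x (s + c)) d.
Proof.
move=> dx; have ds : is_derive t 1 (fun s : R => s + c) 1.
  by apply: is_derive_eq; rewrite addr0.
apply: (is_derive_eq (@is_derive1_comp _ x (fun s => s + c) t d 1 dx ds)).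
by rewrite mulr1.
Qed.

Lemma global_center_all_closed (g f : {poly R}) :
  global_center (lienard g f) (0, 0) ->
  g.[0] = 0 /\ all_closed (horner g) (horner f).
Proof.
move=> [[eq0 _] [[fill _ _] _]]; split.
  by move: eq0 => /(congr1 snd) /=; rewrite mulr0 subr0 => /eqP; rewrite oppr_eq0 => /eqP.
move=> x0 y0 q0.
have [|gam [[phi [sol [T T0 per] [t1 nc] ->]] _ [t0 _ phit0] avoid]] := fill (x0, y0).
  by move=> /= [x00 y00]; move: q0; rewrite x00 y00 eqxx.
exists (fun t => (phi (t + t0)).1), (fun t => (phi (t + t0)).2), T; split.
- split => //.
  + by move=> u; rewrite addrAC per.
  + by move=> u; rewrite addrAC per.
  + move=> t; apply: (is_derive_translate (x := fun t => (phi t).1)).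
    by have [] := is_derive_pair (sol (t + t0)).
  + move=> t; apply: (is_derive_translate (x := fun t => (phi t).2)).
    by have [] := is_derive_pair (sol (t + t0)).
- by rewrite add0r phit0.
- by rewrite add0r phit0.
- move=> t; rewrite -negb_and; apply/negP => /andP[/eqP e1 /eqP e2].
  apply: (avoid (phi (t + t0))); first by exists (t + t0).
  by rewrite /= [phi _]surjective_pairing e1 e2.
have ne (p : R * R) : p != (x0, y0) -> (p.1 != x0) || (p.2 != y0).
  by case: p => p1 p2; rewrite xpair_eqE negb_and.
(* Since [phi t1] and [phi 0] differ, at least one of them is not [phi t0]. *)
have [e|n] := eqVneq (phi t1) (phi t0).
  by exists (- t0); apply: ne; rewrite addNr -phit0 -e eq_sym.
by exists (t1 - t0); apply: ne; rewrite subrK -phit0.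
Qed.

End Real.

Theorem theorem4 (R : realType) (m n r s : nat) (a b : nat -> R)
    (hrm : (r <= m)%N) (hsn : (s <= n)%N)
    (hab : a r * a m * b s * b n != 0)
    (hdeg : maxn m n.+1 = 5%N) :
  let X := lienard (poly_between a r m) (poly_between b s n) in
  (global_center X (0, 0) -> linear_type X (0, 0) ->
     exists A B : R, [/\ -2 < A, B != 0 &
       rescales_to X (fun p =>
         (p.2, - (p.1 + A * p.1 ^+ 3 + p.1 ^+ 5) - B * p.1 * p.2))]) /\
  (global_center X (0, 0) -> nilpotent_type X (0, 0) ->
     exists2 C : R,
       (- (2 * Num.sqrt 2) < C < 0) \/ (0 < C < 2 * Num.sqrt 2) &
       rescales_to X (fun p =>
         (p.2, - (p.1 ^+ 3 + p.1 ^+ 5) - C * p.1 * p.2))).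
Proof.
move=> X.
have m5 : (m <= 5)%N by rewrite -hdeg leq_maxl.
have n4 : (n <= 4)%N by rewrite -ltnS -hdeg leq_maxr.
have [am bn] : a m != 0 /\ b n != 0.
  by move: hab; rewrite !mulf_eq0 !negb_or => /andP[/andP[/andP[_ ->] _] ->].
pose A := range_coef a r m; pose B := range_coef b s n.
(* Common to both types, each of which gives f (0) = 0: g has degree 5 and f is a nonzero multiple
   of x. *)
have reduce : global_center X (0, 0) -> (poly_between b s n).[0] = 0 ->
    exists c, [/\ c != 0, 0 < A 5%N,
      all_closed (quintic (A 1%N) (A 2%N) (A 3%N) (A 4%N) (A 5%N)) (fun u => c * u) &
      X = (fun p => (p.2, - quintic (A 1%N) (A 2%N) (A 3%N) (A 4%N) (A 5%N) p.1 - c * p.1 * p.2))].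
  move=> /global_center_all_closed[g0 AC] f0.
  have B5 : B 5%N = 0 
    by rewrite /B /range_coef ifF //; apply/negP => /andP[_ /leq_trans /(_ n4)].
  have gE u : (poly_between a r m).[u] = quintic (A 1%N) (A 2%N) (A 3%N) (A 4%N) (A 5%N) u.
    move: g0; rewrite !horner_poly_between // /quintic !expr0n /= !mulr0 !addr0 => ->.
    by rewrite add0r.
  have B0 : B 0%N = 0.
    by move: f0; rewrite horner_poly_between ?(leq_trans n4) // /quintic !expr0n /= !mulr0 !addr0.
  have fE u : (poly_between b s n).[u] = quartic (B 1%N) (B 2%N) (B 3%N) (B 4%N) u.
    rewrite horner_poly_between ?(leq_trans n4) // -/B B0 B5 /quintic /quartic.
    by rewrite mul0r addr0 add0r.
  have AC' : all_closed (quintic (A 1%N) (A 2%N) (A 3%N) (A 4%N) (A 5%N))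
      (quartic (B 1%N) (B 2%N) (B 3%N) (B 4%N)).
    by move: AC; congr (all_closed _ _); apply/funext => u.
  have [B3 B4 H] := all_closed_damping AC'.
  have Bn : B n = b n by rewrite /B /range_coef hsn leqnn.
  (* The degree 5 could also come from n = 4, but then b_n would be the vanishing coefficient
     [B 4]. *)
  have m_eq : m = 5%N.
    have [e|e] : m = 5%N \/ n = 4%N.
        by move: hdeg; rewrite /maxn; case: ifP => _ e; [right; case: e | left].
      by [].
    by move: bn; rewrite -Bn e B4 eqxx.
  have A5 : A 5%N != 0 by rewrite /A /range_coef -m_eq hrm leqnn.
  have [A5p B2] := H A5.
  have B1 : B 1%N != 0.
    move: bn; rewrite -Bn; case: (n) n4 => [|[|[|[|[|//]]]]] _ //.
    - by rewrite B0 eqxx.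
    - by rewrite B2 eqxx.
    - by rewrite B3 eqxx.
    - by rewrite B4 eqxx.
  exists (B 1%N); split=> //.
    move: AC'; congr (all_closed _ _); apply/funext => u.
    by rewrite /quartic B2 B3 B4 !mul0r !addr0.
  apply/funext => p; rewrite /X /lienard gE fE /quartic B2 B3 B4.
  by rewrite !mul0r !addr0.
have cl c : continuous (fun u : R => c * u).
  by move=> u; apply: is_derive_continuous; apply: is_derive_eq.
split=> GC ty.
  have [f0 g1] := linear_type_lienard ty.
  rewrite deriv_poly_between0 // -/A in g1.
  have [c [c0 A5 AC XE]] := reduce GC f0.
  have A2 := all_closed_quadratic_restoring AC g1 c0.
  rewrite A2 in AC XE; have A4 := all_closed_even_part c0 AC.
  rewrite A4 in AC XE; have [gpos _] := all_closed_quintic_sign AC (cl c).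
  by rewrite XE; exact: rescale_linear.
have [f0 g1] := nilpotent_type_lienard ty.
rewrite deriv_poly_between0 // -/A in g1.
have [c [c0 A5 AC XE]] := reduce GC f0.
rewrite g1 in AC XE; have [A2 A3] := all_closed_nilpotent_coef AC (cl c).
rewrite A2 in AC XE; have A4 := all_closed_even_part c0 AC.
rewrite A4 in AC XE.
have c2 : c ^+ 2 < 8 * A 3%N.
  have [cp|cn] := ltP 0 c; first exact: all_closed_monodromy AC A3 A5 cp.
  rewrite -sqrrN; apply: (@all_closed_monodromy _ (A 3%N) (A 5%N)) => //.
    by move: (all_closed_reverse AC); congr (all_closed _ _); apply/funext => u; rewrite mulNr.
  by rewrite oppr_gt0 lt_neqAle c0.
have A3p : 0 < A 3%N by have := sqr_ge0 c; lra.
by rewrite XE; exact: rescale_nilpotent.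
Qed.
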